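(* Let $n\ge 1$, let $X = M_n(\mathbf{C})\times \mathbf{C}^n$, and let $f\in\mathbf{C}[X]$ be the polynomial function $$f(M,v)=\det\,[\,v\ \ Mv\ \ M^2v\ \ \ldots\ \ M^{n-1}v\,].$$ Then the Bernstein-Sato $b$-function of $f$ is $$\tilde b(s)=\prod_{0\le c<d\le n}\left(s+1+\frac{c}{d}\right),$$ where the product is over all pairs of integers $(c,d)$ with $0\le c<d\le n$.
   Context: $M_n(\mathbf{C})$ is the space of complex $n\times n$ matrices. $[\,v\ Mv\ \ldots\ M^{n-1}v\,]$ is the $n\times n$ matrix with the indicated columns. $D_X$ is the ring of algebraic differential operators on $X$ (the Weyl algebra in the $n^2+n$ coordinates), and $D_X[s]=\mathbf{C}[s]\otimes D_X$, where $s$ is an indeterminate commuting with $D_X$. The Bernstein-Sato $b$-function of $f$ is the monic polynomial $b(s)\in\mathbf{C}[s]$ of minimal degree such that there is an operator $D\in D_X[s]$ with $D f^{s+1}=b(s)f^s$, where $f^s$ is the usual formal symbol on which derivations act by $\partial(f^s)=s\,\partial(f)\,f^{-1}f^{s}$, and $f^{s+1}=f\cdot f^s$. (The set of all $b(s)$ for which such a $D$ exists is an ideal of $\mathbf{C}[s]$.) *)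

(* Defs.v *)
From HB Require Import structures.
From mathcomp Require Import all_boot all_order all_algebra.
From mathcomp Require Import reals.
From mathcomp Require Import ssrcomplements complex mpoly.
From mathcomp Require Import ring.

Set Implicit Arguments.
Unset Strict Implicit.
Unset Printing Implicit Defensive.

Import Order.TTheory GRing.Theory Num.Theory.
Local Open Scope ring_scope.
Local Open Scope quotient_scope.

Notation "x %:F" := (tofrac x) : ring_scope.

(* D_X[s] for X the affine N-space over C, in normally ordered form: since
   D_X[s] is a free left C[s][X]-module on the monomials
   'd^b = 'd_0^(b 0) ... 'd_(N-1)^(b (N-1)), an operator \sum_b P_b(s, x) 'd^b
   is the polynomial in the symbols 'd_i whose coefficient at b is P_b.  Only
   the underlying module is used: the product of {mpoly _} is NOT composition
   of operators.  See fs_deriv_coord and fs_derivC for the Weyl relations, and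
   weyl_act_comp for closure under composition. *)
Definition weyl_s (C : fieldType) (N : nat) :=
  {mpoly {mpoly {poly C}[N]}[N]}.

Section FractionDerivation.
Variables (A : idomainType) (N : nat).
Implicit Types (i j : 'I_N) (p q : {mpoly A[N]}) (x y : {fraction {mpoly A[N]}}).

(* The quotient rule, on the chosen representative of a fraction;
   frac_deriv_div shows that the choice is immaterial. *)
Definition frac_deriv i x : {fraction {mpoly A[N]}} :=
  let p := \n_(repr x) in let q := \d_(repr x) in
  (mderiv i p * q - p * mderiv i q)%:F / (q ^+ 2)%:F.

Lemma fracE x : x = (\n_(repr x))%:F / (\d_(repr x))%:F.
Proof.
have d0 := denom_ratioP (repr x).
apply: (canRL (mulfK _)); first by rewrite tofrac_eq0.
rewrite -{1}[x]reprK; set r := repr x in d0 *; clearbody r.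
change (FracField.mul (\pi r) (tofrac \d_r) = tofrac \n_r).
apply/eqP; rewrite piE /FracField.mulf.
rewrite FracField.equivfE !numden_Ratio ?mulr1 ?oner_neq0 //.
by rewrite mulrC.
Qed.

Lemma frac_deriv_div i p q : q != 0 ->
  frac_deriv i (p%:F / q%:F) =
  (mderiv i p * q - p * mderiv i q)%:F / (q ^+ 2)%:F.
Proof.
move=> q0; rewrite /frac_deriv; set r := repr _.
have d0 := denom_ratioP r.
have E := fracE (p%:F / q%:F); rewrite -/r in E; clearbody r.
move: E d0; move: (\n_r) (\d_r) => a b E b0.
have{}E : p * b = a * q.
  apply/eqP; rewrite -tofrac_eq !tofracM.
  by rewrite -eqr_div ?tofrac_eq0 // E.
have E' := congr1 (mderiv i) E; rewrite !mderivM in E'.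
apply/eqP; rewrite eqr_div ?tofrac_eq0 ?expf_neq0 // -!tofracM tofrac_eq.
rewrite -subr_eq0; apply/eqP.
move: (mderiv i p) (mderiv i q) (mderiv i a) (mderiv i b) E' => p' q' a' b' E'.
transitivity (- (b * q) * (p' * b + p * b' - (a' * q + a * q'))
   + (q * b' + b * q') * (p * b - a * q)); first by ring.
by rewrite E E' !subrr !mulr0 addr0.
Qed.

Lemma frac_deriv_tofrac i p : frac_deriv i p%:F = (mderiv i p)%:F.
Proof.
have := @frac_deriv_div i p 1 (oner_neq0 _).
by rewrite -mpolyC1 mderivC mpolyC1 mulr0 subr0 expr1n tofrac1 !divr1 mulr1.
Qed.

Lemma frac_ind (P : {fraction {mpoly A[N]}} -> Prop) :
  (forall p q, q != 0 -> P (p%:F / q%:F)) -> forall x, P x.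
Proof. by move=> H x; rewrite [x]fracE; apply: H; apply: denom_ratioP. Qed.

Lemma frac_derivD i : {morph frac_deriv i : x y / x + y}.
Proof.
elim/frac_ind=> p q q0; elim/frac_ind=> a b b0.
rewrite addf_div ?tofrac_eq0 // -!tofracM -tofracD.
rewrite !frac_deriv_div ?mulf_neq0 // addf_div ?tofrac_eq0 ?expf_neq0 //.
rewrite -!tofracM -tofracD; apply/eqP.
rewrite eqr_div ?tofrac_eq0 ?mulf_neq0 ?expf_neq0 ?mulf_neq0 //.
rewrite -!tofracM tofrac_eq !(mderivM, mderivD); apply/eqP; ring.
Qed.

Lemma frac_derivM i x y :
  frac_deriv i (x * y) = frac_deriv i x * y + x * frac_deriv i y.
Proof.
elim/frac_ind: x => p q q0; elim/frac_ind: y => a b b0.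
rewrite mulf_div -!tofracM !frac_deriv_div ?mulf_neq0 //.
rewrite !mulf_div addf_div -?tofracM ?tofrac_eq0 ?mulf_neq0 ?expf_neq0 //.
rewrite -tofracD; apply/eqP.
rewrite eqr_div ?tofrac_eq0 ?mulf_neq0 ?expf_neq0 ?mulf_neq0 ?expf_neq0 //.
rewrite -!tofracM tofrac_eq !(mderivM, mderivD); apply/eqP; ring.
Qed.

Lemma frac_derivC i j x :
  frac_deriv i (frac_deriv j x) = frac_deriv j (frac_deriv i x).
Proof.
elim/frac_ind: x => p q q0.
rewrite !(frac_deriv_div _ _ q0) !frac_deriv_div ?expf_neq0 //; apply/eqP.
rewrite eqr_div ?tofrac_eq0 ?expf_neq0 // -!tofracM tofrac_eq expr2.
rewrite !(mderivM, mderivB) [mderiv j (mderiv i p)]mderiv_comm.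
rewrite [mderiv j (mderiv i q)]mderiv_comm; apply/eqP; ring.
Qed.

End FractionDerivation.

Section BFunction.
Variables (C : fieldType) (N : nat).
Implicit Types (f : {mpoly C[N]}) (b : {poly C}) (D : weyl_s C N).

(* An element g of fs_mod stands for g f^s in the free module of rank one on
   the symbol f^s over the field of fractions of C[s][X], with s = 'X%:MP%:F.
   It contains C[X][s, 1/f] f^s as the sub-D_X[s]-module of those g whose
   denominator is a power of f. *)
Definition fs_mod := {fraction {mpoly {poly C}[N]}}.

Definition fs_of f : fs_mod := (map_mpoly polyC f)%:F.
Definition fs_scalar b : fs_mod := (b%:MP_[N])%:F.

(* 'd_i (g f^s) = ('d_i g + g s 'd_i(f) f^-1) f^s *)
Definition fs_deriv f (i : 'I_N) (g : fs_mod) : fs_mod :=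
  frac_deriv i g + g * (fs_scalar 'X * fs_of (mderiv i f) / fs_of f).

Definition fs_derivm f (m : 'X_{1..N}) (g : fs_mod) : fs_mod :=
  foldr (fun i => iter (m i) (fs_deriv f i)) g (enum 'I_N).

Definition weyl_act f D (g : fs_mod) : fs_mod :=
  \sum_(m <- msupp D) (D@_m)%:F * fs_derivm f m g.

(* D f^(s+1) = b(s) f^s, where f^(s+1) = f . f^s *)
Definition b_equation f b : Prop :=
  exists D : weyl_s C N, weyl_act f D (fs_of f) = fs_scalar b.

Definition is_b_function f b : Prop :=
  [/\ b \is monic, b_equation f b &
      forall b' : {poly C}, b' \is monic -> b_equation f b' ->
        (size b <= size b')%N].

End BFunction.

Section WeylAction.
Variables (C : fieldType) (N : nat) (f : {mpoly C[N]}).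
Implicit Types (i j : 'I_N) (g h : fs_mod C N) (m : 'X_{1..N}).

Lemma fs_derivD i : {morph fs_deriv f i : g h / g + h}.
Proof. by move=> g h; rewrite /fs_deriv frac_derivD mulrDl addrACA. Qed.

Lemma fs_derivM i h g :
  fs_deriv f i (h * g) = frac_deriv i h * g + h * fs_deriv f i g.
Proof. by rewrite /fs_deriv frac_derivM mulrDr -(mulrA h) addrA. Qed.

Lemma fs_deriv_coord i j g :
  fs_deriv f i (('X_j)%:F * g) = ('X_j)%:F * fs_deriv f i g + g *+ (i == j).
Proof.
rewrite fs_derivM frac_deriv_tofrac mderivX mnm1E eq_sym addrC; congr (_ + _).
have [->|_] := eqVneq i j; last by rewrite scale0r tofrac0 mul0r.
have -> : (U_(j) - U_(j) = 0)%MM by apply/mnmP => k; rewrite mnmBE subnn mnm0E.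
by rewrite scale1r mpolyX0 tofrac1 mul1r.
Qed.

Lemma fs_derivC i j g :
  fs_deriv f i (fs_deriv f j g) = fs_deriv f j (fs_deriv f i g).
Proof.
pose a k : fs_mod C N := fs_scalar N 'X * fs_of (mderiv k f) / fs_of f.
have fs_derivE k h : fs_deriv f k h = frac_deriv k h + h * a k by [].
have aC : frac_deriv i (a j) = frac_deriv j (a i).
  rewrite /a /fs_scalar /fs_of -!tofracM.
  have [->|f0] := eqVneq (map_mpoly polyC f) 0.
    by rewrite tofrac0 invr0 !mulr0 -tofrac0 !frac_deriv_tofrac !mderiv0.
  have md k p : map_mpoly polyC (mderiv k p) = mderiv k (map_mpoly polyC p).
    apply/mpolyP => m; rewrite mcoeff_map_mpoly !mcoeff_mderiv.
    by rewrite mcoeff_map_mpoly /= polyCMn.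
  rewrite !frac_deriv_div // !md !mderiv_mulC [mderiv i (mderiv j _)]mderiv_comm.
  by congr (_%:F / _); ring.
clearbody a; rewrite !fs_derivE !frac_derivD !(frac_derivM _ g (a _)) aC.
rewrite (frac_derivC i j).
move: (frac_deriv j (a i)) (frac_deriv i g) (frac_deriv j g) (frac_deriv j _).
by move=> u v w z; ring.
Qed.

Lemma fs_derivmC i m g :
  fs_deriv f i (fs_derivm f m g) = fs_derivm f m (fs_deriv f i g).
Proof.
rewrite /fs_derivm; elim: (enum _) => //= j s IH; rewrite -IH.
by elim: (m j) => //= k IHk; rewrite fs_derivC IHk.
Qed.

Lemma fs_derivmS i m g :
  fs_derivm f (m + U_(i))%MM g = fs_deriv f i (fs_derivm f m g).
Proof.
rewrite /fs_derivm.
have: count_mem i (enum 'I_N) = 1%N.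
  by rewrite count_uniq_mem ?enum_uniq ?mem_enum.
elim: (enum _) => //= j s IH; rewrite mnmDE mnm1E eq_sym.
have itC k h : iter k (fs_deriv f j) (fs_deriv f i h) =
               fs_deriv f i (iter k (fs_deriv f j) h).
  by elim: k => //= k ->; rewrite fs_derivC.
have [->|ij] := eqVneq j i; rewrite ?(addn0, add0n) => ci.
  rewrite addn1 /=; congr (fs_deriv _ _ (iter _ _ _)).
  case: ci; elim: {IH} s => //= k s IHs; case: (eqVneq k i) => //= ki /IHs ->.
  by rewrite mnmDE mnm1E eq_sym (negPf ki) addn0.
by rewrite IH // itC.
Qed.

Lemma weyl_actwE D g k : (msize D <= k)%N ->
  weyl_act f D g = \sum_(m : 'X_{1..N < k}) (D@_m)%:F * fs_derivm f m g.
Proof.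
move=> le; rewrite /weyl_act (big_mksub 'X_{1..N < k}) /=; first last.
+ by move=> m /msize_mdeg_lt /leq_trans; apply.
+ by rewrite msupp_uniq.
rewrite big_rmcond //= => m /memN_msupp_eq0 ->.
by rewrite tofrac0 mul0r.
Qed.

Lemma weyl_actD D E g : weyl_act f (D + E) g = weyl_act f D g + weyl_act f E g.
Proof.
pose k := maxn (msize (D + E)) (maxn (msize D) (msize E)).
rewrite !(@weyl_actwE _ _ k) ?leq_max ?leqnn ?orbT // -big_split /=.
by apply: eq_bigr => m _; rewrite mcoeffD tofracD mulrDl.
Qed.

Lemma weyl_act_mono p m g :
  weyl_act f (p *: 'X_[m]) g = p%:F * fs_derivm f m g.
Proof.
have [->|p0] := eqVneq p 0.
  by rewrite scale0r /weyl_act msupp0 big_nil tofrac0 mul0r.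
have pm : perm_eq (msupp (p *: 'X_[m])) [:: m].
  apply: uniq_perm => [|//|k]; first exact: msupp_uniq.
  rewrite mcoeff_msupp mcoeffZ mcoeffX inE [k == m]eq_sym.
  by case: (m == k); rewrite ?mulr1 ?mulr0 ?eqxx.
rewrite /weyl_act (perm_big _ pm) /= big_seq1.
by rewrite mcoeffZ mcoeffX eqxx mulr1.
Qed.

Lemma weyl_act_comp (D E : weyl_s C N) :
  exists G : weyl_s C N,
    forall g, weyl_act f G g = weyl_act f D (weyl_act f E g).
Proof.
pose op T := exists G : weyl_s C N, forall g, weyl_act f G g = T g.
have opD T U : op T -> op U -> op (fun g => T g + U g).
  by move=> [G HG] [H HH]; exists (G + H) => g; rewrite weyl_actD HG HH.
have opM p T : op T -> op (fun g => p%:F * T g).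
  move=> [G HG]; exists (p *: G) => g; rewrite -HG.
  rewrite !(@weyl_actwE _ _ (msize G)) ?msizeZ_le // mulr_sumr.
  by apply: eq_bigr => m _; rewrite mcoeffZ tofracM mulrA.
have opd i T : op T -> op (fun g => fs_deriv f i (T g)).
  move=> [G HG]; suff [H HH] : op (fun g => fs_deriv f i (weyl_act f G g)).
    by exists H => g; rewrite HH HG.
  elim/mpolyind: G {T HG} => [|p m G _ _ IH].
    exists 0 => g; rewrite /weyl_act msupp0 !big_nil /fs_deriv.
    by rewrite mul0r addr0 -tofrac0 frac_deriv_tofrac mderiv0.
  suff [H HH] : op (fun g => fs_deriv f i (p%:F * fs_derivm f m g)
                             + fs_deriv f i (weyl_act f G g)).
    by exists H => g; rewrite HH weyl_actD weyl_act_mono fs_derivD.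
  apply: opD IH; exists (mderiv i p *: 'X_[m] + p *: 'X_[m + U_(i)]) => g.
  rewrite weyl_actD !weyl_act_mono fs_derivM frac_deriv_tofrac.
  by rewrite fs_derivmS.
elim/mpolyind: D => [|p m D _ _ IH].
  by exists 0 => g; rewrite /weyl_act msupp0 !big_nil.
suff [H HH] : op (fun g => p%:F * fs_derivm f m (weyl_act f E g)
                           + weyl_act f D (weyl_act f E g)).
  by exists H => g; rewrite HH weyl_actD weyl_act_mono.
apply: opD IH; apply: opM; rewrite /fs_derivm; elim: (enum _) => [|i s IH] /=.
  by exists E.
by elim: (m i) => //= k IHk; apply: opd.
Qed.

End WeylAction.

(* The coordinates on M_n(C) x C^n: the first n * n ones are the entries of M,
   the last n the entries of v. *)
Section CyclicDeterminant.
Variables (C : fieldType) (n : nat).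

Definition gen_mx : 'M[{mpoly C[n * n + n]}]_n :=
  \matrix_(i, j) 'X_(lshift n (mxvec_index i j)).

Definition gen_vec : 'cV[{mpoly C[n * n + n]}]_n :=
  \col_i 'X_(rshift (n * n) i).

Definition cyclic_det : {mpoly C[n * n + n]} :=
  \det (\matrix_(i < n, j < n) (gen_mx ^+ j *m gen_vec) i ord0).

End CyclicDeterminant.

(* Main.v *)
Require Import Defs.
From HB Require Import structures.
From mathcomp Require Import all_boot all_order all_algebra.
From mathcomp Require Import reals.
From mathcomp Require Import complex mpoly.
From mathcomp Require Import ssrcomplements.
From mathcomp Require Import ring zify.

Import Order.TTheory GRing.Theory Num.Theory.
Local Open Scope ring_scope.

(** Write [f] for the cyclic determinant and [<P, Q>] for the Fischer pairing,
    the sum over monomials [m] of [m! P_m Q_m], for which multiplication by a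
    variable is adjoint to the corresponding derivation.  Both halves of the
    theorem are read off from pairings of powers of [f] at integer exponents.

    The engine is a slice.  The function [f] is semi-invariant under [GL_n],
    and at [v = e_1] it is the same determinant in size [n - 1], taken at the
    lower right block of [M] and the rest of the first column of [M]
    ([krylov_det_slice]).  Pair two functions in the matrix variables only: the
    result is a polynomial in the vector [v] of the left factor and the vector
    [y] of the right one.  The Fischer pairing is invariant under [g] on the
    left and its contragredient on the right, and a generic pair [(v, y)] can
    be moved to [(e_1, r e_1)] with [r = v . y]; so for powers of [f] this
    polynomial is a power of [r] times a pairing in size [n - 1]
    ([sliced_pairing]).  Pairing finally [v] with [y] turns powers of [r] into
    rising factorials ([contract_dotX]), and these produce the factors
    [n s + n + c] with [0 <= c < n] of the b-function.

    Induction on [n] gives two facts, with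
    [b_n(m) = prod_(0 <= c < d <= n) (d (m + 1) + c)].
    First, [<f Q, f^(m+1)> = b_n(m) <Q, f^m>] for all [Q] ([fischer_cyclic]).
    As the pairing is nondegenerate, this says that the constant coefficient
    operator [f(d)] maps [f^(m+1)] to [b_n(m) f^m], which is the required
    functional equation, and also that
    [<f^(m+1), f^(m+1)> = b_n(m) <f^m, f^m>].
    Second, for fixed [P] and [Q] the pairing [<Q f^m, P f^(m+1)>] is
    [<f^(m+1), f^(m+1)>] times a polynomial in [m]
    ([pairing_quotient_poly]).  Here [P] and [Q] need not be invariant.  Over
    the generic point [(v, y)] the quotient is a polynomial in [m] of bounded
    degree by induction, and interpolation at finitely many exponents, whose
    coefficients do not depend on the point, carries this over to the pairing.

    Minimality follows: if [D f^(s+1) = b(s) f^s], pair both sides with [f^m]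
    at [s = m].  Integrating by parts, the left side is a combination with
    coefficients polynomial in [m] of pairings [<Q f^m, P f^(m+1)>], so
    [b(m) <f^m, f^m> = <f^(m+1), f^(m+1)> q(m)] for some polynomial [q]; hence
    [b(m) = b_n(m) q(m)] for all large [m], and [b_n] divides [b].

    The passage between the formal exponent [s] and integers is harmless since
    an element of the module generated by [f^s] is determined by its values at
    all large integers ([specializes_eq]). *)

(** * The determinant of a Krylov basis *)

Definition krylov_det (A : comNzRingType) n (M : 'M[A]_n) (v : 'cV[A]_n) : A :=
  \det (\matrix_(i < n, j < n) (M ^+ j *m v) i ord0).

Arguments krylov_det {A n} M v.

Lemma krylov_det_map (A B : comNzRingType) (phi : {rmorphism A -> B}) n
    (M : 'M[A]_n) (v : 'cV[A]_n) :
  phi (krylov_det M v) = krylov_det (map_mx phi M) (map_mx phi v).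
Proof.
rewrite /krylov_det -det_map_mx; congr (\det _).
apply/matrixP => i j; rewrite !mxE rmorph_sum; apply: eq_bigr => k _.
by rewrite rmorphM -(rmorphXn (map_mx phi)) !mxE.
Qed.

Lemma krylov_det_conj (A : comNzRingType) n (g h M : 'M[A]_n) (v : 'cV[A]_n) :
  h *m g = 1%:M ->
  krylov_det (g *m M *m h) (g *m v) = \det g * krylov_det M v.
Proof.
move=> hg; rewrite /krylov_det -det_mulmx; congr (\det _).
have E k : (g *m M *m h) ^+ k *m (g *m v) = g *m (M ^+ k *m v).
  elim: k => [|k IH]; first by rewrite !expr0 !mul1mx.
  rewrite exprS -mulmxE -[LHS]mulmxA IH exprS -mulmxE -!mulmxA (mulmxA h) hg.
  by rewrite mul1mx.
apply/matrixP => i j; rewrite mxE E !mxE; apply: eq_bigr => k _.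
by rewrite !mxE.
Qed.

Lemma krylov_det_scale (A : comNzRingType) n (M : 'M[A]_n) c (v : 'cV[A]_n) :
  krylov_det M (c *: v) = c ^+ n * krylov_det M v.
Proof.
rewrite /krylov_det -detZ; congr (\det _); apply/matrixP => i j.
by rewrite !mxE mulr_sumr; apply: eq_bigr => k _; rewrite mxE mulrCA.
Qed.

(** The lower part of [M^(k+1) e_1] is [M'^k w] plus a combination of the
    [M'^i w] with [i < k], where [M'] is the lower right block and [w] the rest
    of the first column: the two Krylov bases differ by a unitriangular
    matrix. *)
Lemma krylov_det_slice (A : comNzRingType) n (M : 'M[A]_(1 + n)) :
  krylov_det M (col_mx 1%:M 0) = krylov_det (drsubmx M) (dlsubmx M).
Proof.
pose u k : 'cV_(1 + n) := M ^+ k *m col_mx 1%:M 0.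
pose t k := usubmx (u k) ord0 ord0.
have uS k : u k.+1 = M *m u k by rewrite /u exprS -mulmxE mulmxA.
have dS k : dsubmx (u k.+1) = \sum_(i < k.+1) t (k - i)%N *: (drsubmx M ^+ i *m
  dlsubmx M).
  have step j : dsubmx (u j.+1) = drsubmx M *m dsubmx (u j) + t j *: dlsubmx M.
    rewrite uS -{1}(submxK M) -{1}(vsubmxK (u j)) mul_block_col col_mxKd addrC.
    by rewrite [usubmx _]mx11_scalar mul_mx_scalar.
  elim: k => [|k IH].
    rewrite step big_ord1 /= /t /u !expr0 !mul1mx col_mxKd col_mxKu mulmx0.
    by rewrite add0r !mxE.
  rewrite step IH [RHS]big_ord_recl /= subn0 expr0 mul1mx addrC mulmx_sumr;
    congr (_ + _).
  by apply: eq_bigr => i _;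
    rewrite /bump add1n subSS exprS -mulmxE -mulmxA -!scalemxAr.
(* The Toeplitz matrix of the change of basis. *)
pose T : 'M[A]_n := \matrix_(i, j) (if (i <= j)%N then t (j - i)%N else 0).
have detT : \det T = 1.
  rewrite -det_tr det_trig; last first.
    apply/is_trig_mxP => i j ij; rewrite !mxE; case: leqP => //.
    by rewrite leqNgt ij.
  by apply: big1 => i _; rewrite !mxE leqnn subnn /t /u expr0 mul1mx col_mxKu
    mxE eqxx.
pose K : 'M[A]_n := \matrix_(i < n, j < n) (drsubmx M ^+ j *m dlsubmx M) i ord0.
pose ur : 'M[A]_(1, n) := \row_j t j.+1.
have detK : \det K = \det (K *m T) by rewrite det_mulmx detT mulr1.
rewrite /krylov_det -/K detK.
rewrite -[RHS]mul1r -[X in X * _](det1 _ 1) -(det_ublock 1%:M ur);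
  congr (\det _).
apply/matrixP => i j.
rewrite mxE -/(u j) -[ i ]splitK -[j]splitK.
case: (split i) => a; case: (split j) => b;
  rewrite /= ?block_mxEul ?block_mxEur ?block_mxEdl ?block_mxEdr.
- by rewrite !ord1 /u expr0 mul1mx col_mxEu.
- by rewrite !ord1 [RHS]mxE /t [RHS]mxE.
- by rewrite ord1 /u expr0 mul1mx col_mxEd.
have -> : u (1 + b)%N (rshift 1 a) ord0 = dsubmx (u (1 + b)%N) a ord0 by
  rewrite [RHS]mxE.
rewrite add1n dS [RHS]mxE summxE (big_ord_widen n (fun i => (t (b - i)%N *:
  (drsubmx M ^+ i *m dlsubmx M)) a ord0)) //.
rewrite big_mkcond; apply: eq_bigr => k _;
  rewrite [X in _ = X * _]mxE [X in _ = _ * X]mxE ltnS.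
by case: ifP; rewrite ?mulr0 // mxE mulrC.
Qed.

(** * The Fischer pairing *)

Lemma mnm_ind N (P : 'X_{1..N} -> Prop) :
  P 0%MM -> (forall i m, P m -> P (U_(i) + m)%MM) -> forall m, P m.
Proof.
move=> P0 PS m; have [k] := ubnP (mdeg m); elim: k m => // k IH m lt_mk.
have [->//|m0] := eqVneq m 0%MM.
have [i mi] : exists i, m i != 0%N.
  apply/existsP; apply: contraNT m0; rewrite negb_exists => /forallP m0.
  by apply/eqP/mnmP => i; rewrite mnm0E; apply/eqP; have := m0 i; rewrite negbK.
have E : (U_(i) + (m - U_(i)))%MM = m by rewrite addmC submK ?lep1mP.
rewrite -E; apply/PS/IH; move: lt_mk; rewrite -{1}E mdegD mdeg1 add1n.
by rewrite ltnS.
Qed.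

Section AdditiveExtension.
Variables (A : comNzRingType) (V : zmodType).

Lemma mpoly_additive_ext N (B1 B2 : {mpoly A[N]} -> V) :
    {morph B1 : x y / x + y} -> {morph B2 : x y / x + y} ->
    (forall c m, B1 (c *: 'X_[m]) = B2 (c *: 'X_[m])) -> B1 =1 B2.
Proof.
move=> D1 D2 E.
have Z (B : {mpoly A[N]} -> V) : {morph B : x y / x + y} -> B 0 = 0.
  by move=> D; apply: (addrI (B 0)); rewrite -D !addr0.
move=> F; elim/mpolyind: F => [|c m F _ _ IH]; first by rewrite !Z.
by rewrite D1 D2 IH E.
Qed.

Lemma mpoly_biadditive_ext N N' (B1 B2 : {mpoly A[N]} -> {mpoly A[N']} -> V) :
    (forall H, {morph B1^~ H : x y / x + y}) ->
    (forall F, {morph B1 F : x y / x + y}) ->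
    (forall H, {morph B2^~ H : x y / x + y}) ->
    (forall F, {morph B2 F : x y / x + y}) ->
    (forall c m d k, B1 (c *: 'X_[m]) (d *: 'X_[k]) =
                     B2 (c *: 'X_[m]) (d *: 'X_[k])) ->
  forall F H, B1 F H = B2 F H.
Proof.
move=> L1 R1 L2 R2 E F H.
apply: (mpoly_additive_ext _ (B1^~ H) (B2^~ H)) => // c m.
by apply: (mpoly_additive_ext _ (B1 _) (B2 _)) => // d k.
Qed.

End AdditiveExtension.

Arguments mpoly_additive_ext {A V N} B1 B2.
Arguments mpoly_biadditive_ext {A V N N'} B1 B2.

Definition mfact N (m : 'X_{1..N}) : nat := (\prod_(i < N) (m i)`!)%N.

Arguments mfact {N} m.

HB.lock Definition fischer (A : comNzRingType) N (F H : {mpoly A[N]}) : A :=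
  \sum_(m <- msupp F) F@_m * H@_m * (mfact m)%:R.

Arguments fischer.body {A N} F H.

Section FischerPairing.
Variables (A : comNzRingType) (N : nat).
Implicit Types (F G H : {mpoly A[N]}) (i j : 'I_N) (m : 'X_{1..N}).

Lemma fischerwE F H k : (msize F <= k)%N ->
  fischer F H = \sum_(m : 'X_{1..N < k}) F@_m * H@_m * (mfact m)%:R.
Proof.
move=> le; rewrite fischer.unlock (big_mksub 'X_{1..N < k}) /=; first last.
+ by move=> m /msize_mdeg_lt /leq_trans; apply.
+ by rewrite msupp_uniq.
by rewrite big_rmcond //= => m /memN_msupp_eq0 ->; rewrite !mul0r.
Qed.

Lemma fischerC F H : fischer F H = fischer H F.
Proof.
rewrite !(fischerwE _ _ (maxn (msize F) (msize H))) ?leq_maxl ?leq_maxr //.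
by apply: eq_bigr => m _; rewrite (mulrC F@_m).
Qed.

Lemma fischerDr F : {morph fischer F : G H / G + H}.
Proof.
move=> G H; rewrite fischer.unlock -big_split /=; apply: eq_bigr => m _.
by rewrite mcoeffD mulrDr mulrDl.
Qed.

Lemma fischerZr c F H : fischer F (c *: H) = c * fischer F H.
Proof.
rewrite fischer.unlock mulr_sumr; apply: eq_bigr => m _.
by rewrite mcoeffZ mulrCA -!mulrA.
Qed.

Lemma fischerDl H : {morph fischer^~ H : F G / F + G}.
Proof. by move=> F G; rewrite !(fischerC _ H) fischerDr. Qed.

Lemma fischerZl c F H : fischer (c *: F) H = c * fischer F H.
Proof. by rewrite !(fischerC _ H) fischerZr. Qed.

Lemma fischer0r F : fischer F 0 = 0.
Proof. by rewrite -(scale0r 0) fischerZr mul0r. Qed.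

Lemma fischer0l F : fischer 0 F = 0.
Proof. by rewrite fischerC fischer0r. Qed.

Lemma fischer_sumr F (I : Type) (r : seq I) (P : pred I) (E : I -> {mpoly
  A[N]}) :
  fischer F (\sum_(i <- r | P i) E i) = \sum_(i <- r | P i) fischer F (E i).
Proof. exact: (big_morph _ (fischerDr F) (fischer0r F)). Qed.

Lemma fischer_suml H (I : Type) (r : seq I) (P : pred I) (E : I -> {mpoly
  A[N]}) :
  fischer (\sum_(i <- r | P i) E i) H = \sum_(i <- r | P i) fischer (E i) H.
Proof. exact: (big_morph _ (fischerDl H) (fischer0l H)). Qed.

Lemma fischer_coef m H : fischer 'X_[m] H = H@_m * (mfact m)%:R.
Proof. by rewrite fischer.unlock msuppX big_seq1 mcoeffX eqxx mul1r. Qed.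

Lemma fischer_monom m k : fischer 'X_[A, m] 'X_[k] = (m == k)%:R * (mfact m)%:R.
Proof. by rewrite fischer_coef mcoeffX eq_sym. Qed.

Lemma mfactDU m i : mfact (m + U_(i))%MM = (mfact m * (m i).+1)%N.
Proof.
rewrite /mfact (bigD1 i) //= [X in _ = (X * _)%N](bigD1 i) //=.
rewrite mnmDE mnm1E eqxx addn1 factS.
have -> : (\prod_(j < N | j != i) ((m + U_(i))%MM j)`! =
          \prod_(j < N | j != i) (m j)`!)%N.
  by apply: eq_bigr => j ji; rewrite mnmDE mnm1E eq_sym (negPf ji) addn0.
by rewrite -mulnA mulnC.
Qed.

Lemma fischerXl i F H : fischer ('X_i * F) H = fischer F (H^`M(i)).
Proof.
apply: (mpoly_additive_ext (fun F => fischer ('X_i * F) H)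
  (fun F => fischer F (H^`M(i)))).
- by move=> x y; rewrite mulrDr fischerDl.
- by move=> x y; rewrite fischerDl.
move=> c m; rewrite -scalerAr !fischerZl -mpolyXD addmC !fischer_coef mfactDU.
by rewrite mcoeff_mderiv natrM -mulr_natr; ring.
Qed.

Lemma fischerXr i F H : fischer F ('X_i * H) = fischer (F^`M(i)) H.
Proof. by rewrite fischerC fischerXl fischerC. Qed.

Lemma fischerXm m F H : fischer ('X_[m] * F) H = fischer F (H^`M[m]).
Proof.
elim/mnm_ind: m F H => [|i m IH] F H; first by rewrite mpolyX0 mul1r mderivm0m.
by rewrite mpolyXD -mulrA fischerXl IH mderivmDm mderivmU1m.
Qed.

End FischerPairing.

Lemma mpoly_rmorph_ext (A B : comNzRingType) N
    (phi psi : {rmorphism {mpoly A[N]} -> B}) :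
    (forall c, phi c%:MP = psi c%:MP) -> (forall i, phi 'X_i = psi 'X_i) ->
  phi =1 psi.
Proof.
move=> EC EX; apply: mpoly_additive_ext; try exact: rmorphD.
move=> c m; rewrite -mul_mpolyC !rmorphM EC; congr (_ * _).
elim/mnm_ind: m => [|i m IH]; first by rewrite mpolyX0 !rmorph1.
by rewrite mpolyXD !rmorphM EX IH.
Qed.

Arguments mpoly_rmorph_ext {A B N} phi psi.

(** * Invariance of the pairing *)

Section LinearSubstitution.
Variables (A : comNzRingType) (N : nat).
Implicit Types (F H : {mpoly A[N]}) (S : 'M[A]_N).

Definition lsubst S : {mpoly A[N]} -> {mpoly A[N]} :=
  mmap (@mpolyC N A) (fun i => \sum_j S i j *: 'X_j).

HB.instance Definition _ S := GRing.RMorphism.on (lsubst S).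

Lemma lsubstC S c : lsubst S c%:MP = c%:MP.
Proof. exact: mmapC. Qed.

Lemma lsubstX S i : lsubst S 'X_i = \sum_j S i j *: 'X_j.
Proof. by rewrite /lsubst mmapX mmap1U. Qed.

Lemma lsubstZ S c F : lsubst S (c *: F) = c *: lsubst S F.
Proof. by rewrite -!mul_mpolyC rmorphM /= lsubstC. Qed.

Lemma lsubst_coef0 S H : (lsubst S H)@_0%MM = H@_0%MM.
Proof.
apply: (mpoly_additive_ext (fun H => (lsubst S H)@_0%MM) (mcoeff 0%MM)).
- by move=> x y; rewrite rmorphD mcoeffD.
- by move=> x y; rewrite mcoeffD.
move=> c m; rewrite lsubstZ !mcoeffZ; congr (_ * _).
elim/mnm_ind: m => [|i m _]; first by rewrite mpolyX0 rmorph1.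
rewrite mpolyXD rmorphM /= lsubstX !rmorphM /= raddf_sum /= big1 ?mul0r.
  by rewrite mcoeffX mnm1_eq0 mul0r.
by move=> j _; rewrite mcoeffZ mcoeffX mnm1_eq0 mulr0.
Qed.

Lemma mderivXU i k : ('X_k : {mpoly A[N]})^`M(i) = (k == i)%:R.
Proof.
rewrite mderivX mnm1E; case: eqP => [->|_]; last by rewrite scale0r.
have -> : (U_(i) - U_(i) = 0)%MM by apply/mnmP => l; rewrite mnmBE subnn mnm0E.
by rewrite scale1r mpolyX0.
Qed.

Lemma mderiv_lsubst S H i :
  (lsubst S H)^`M(i) = \sum_j S j i *: lsubst S (H^`M(j)).
Proof.
apply: (mpoly_additive_ext (fun H => (lsubst S H)^`M(i))
  (fun H => \sum_j S j i *: lsubst S (H^`M(j)))).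
- by move=> x y; rewrite rmorphD mderivD.
- move=> x y; rewrite -big_split; apply: eq_bigr => j _ /=.
  by rewrite mderivD rmorphD scalerDr.
move=> c m; rewrite lsubstZ mderivZ.
under eq_bigr => j _ do rewrite mderivZ lsubstZ scalerA mulrC -scalerA.
rewrite -scaler_sumr; congr (_ *: _).
elim/mnm_ind: m => [|k m IH].
  rewrite mpolyX0 rmorph1 -mpolyC1 mderivC big1 // => j _.
  by rewrite mderivC rmorph0 scaler0.
rewrite mpolyXD rmorphM mderivM /= IH lsubstX raddf_sum /=.
under [in RHS]eq_bigr => j _ do
  rewrite mderivM mderivXU rmorphD !rmorphM rmorph_nat scalerDr /= lsubstX.
rewrite big_split /=; congr (_ + _).
  rewrite mulr_suml [LHS](bigD1 i) //= [in LHS]big1 ?addr0; last first.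
    by move=> j ji; rewrite mderivZ mderivXU (negPf ji) scaler0 mul0r.
  rewrite [RHS](bigD1 k) //= [in RHS]big1 ?addr0; last first.
    by move=> j jk; rewrite eq_sym (negPf jk) mul0r scaler0.
  by rewrite mderivZ mderivXU !eqxx -scalerAl.
rewrite mulr_sumr; apply: eq_bigr => j _.
by rewrite -scalerAr.
Qed.

(** The pairing is the natural duality between the symmetric algebra of a space
    and that of its dual, so that a linear substitution is moved to the other
    side by transposing it. *)
Lemma fischer_lsubst S F H : fischer (lsubst S F) H = fischer F (lsubst S^T H).
Proof.
apply: (mpoly_additive_ext (fun F => fischer (lsubst S F) H)
  (fun F => fischer F (lsubst S^T H))).
- by move=> x y; rewrite rmorphD fischerDl.
- by move=> x y; rewrite fischerDl.
move=> c m; rewrite lsubstZ !fischerZl; congr (_ * _).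
elim/mnm_ind: m H => [|k m IH] H.
  by rewrite mpolyX0 rmorph1 -mpolyX0 !fischer_coef lsubst_coef0.
rewrite mpolyXD rmorphM /= lsubstX fischerXl mderiv_lsubst mulr_suml.
rewrite fischer_suml fischer_sumr; apply: eq_bigr => j _.
by rewrite mxE -scalerAl fischerZl fischerXl IH fischerZr.
Qed.

End LinearSubstitution.

Arguments lsubst {A N} S.

Section PointEvaluation.

(** The value at a matrix and a vector with entries in any algebra; the
    coordinates are numbered as in [gen_mx] and [gen_vec]. *)
Definition pteval (A B : comNzRingType) (sigma : {rmorphism A -> B}) n
    (M : 'M[B]_n) (v : 'cV[B]_n) : {mpoly A[n * n + n]} -> B :=
  mmap sigma (fun i => row_mx (mxvec M) v^T ord0 i).

Arguments pteval {A B} sigma {n} M v.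

HB.instance Definition _ A B sigma n M v := GRing.RMorphism.on (@pteval A B
  sigma n M v).

Variables (A B : comNzRingType) (sigma : {rmorphism A -> B}) (n : nat).
Variables (M : 'M[B]_n) (v : 'cV[B]_n).
Notation ev := (pteval sigma M v).

Lemma ptevalC c : ev c%:MP = sigma c.
Proof. exact: mmapC. Qed.

Lemma ptevalZ c F : ev (c *: F) = sigma c * ev F.
Proof. by rewrite -mul_mpolyC rmorphM /= ptevalC. Qed.

Lemma ptevalM i j : ev 'X_(lshift n (mxvec_index i j)) = M i j.
Proof. by rewrite /pteval mmapX mmap1U row_mxEl mxvecE. Qed.

Lemma ptevalv i : ev 'X_(rshift (n * n) i) = v i ord0.
Proof. by rewrite /pteval mmapX mmap1U row_mxEr mxE. Qed.

End PointEvaluation.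

Arguments pteval {A B} sigma {n} M v.

Definition generic_mx (A : comNzRingType) n : 'M[{mpoly A[n * n]}]_n :=
  \matrix_(i, j) 'X_(mxvec_index i j).

Section Conjugation.
Variables (A : comNzRingType) (n : nat).
Implicit Types (g h : 'M[A]_n) (F H : {mpoly A[n * n]}).
Notation X := (generic_mx A n).
Notation cst := (map_mx (@mpolyC (n * n) A)).

(** The matrix of [M |-> g M h] acting on coordinate functions, whence the
    transposes. *)
Definition conj_mx g h : 'M[A]_(n * n) := lin_mx (fun M => g^T *m M *m h^T).

Lemma conj_mxE g h i j k l :
  conj_mx g h (mxvec_index i j) (mxvec_index k l) = g i k * h l j.
Proof.
rewrite !mxE /= vec_mx_delta mxvecE mxE (bigD1 j) //= big1 ?addr0.
  rewrite !mxE (bigD1 i) //= big1 ?addr0.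
    by rewrite !mxE !eqxx mulr1.
  by move=> p pi; rewrite !mxE (negPf pi) mulr0.
move=> q qj; rewrite !mxE big1 ?mul0r // => p _.
by rewrite !mxE (negPf qj) andbF mulr0.
Qed.

Lemma conj_mx_tr g h : (conj_mx g h)^T = conj_mx g^T h^T.
Proof.
apply/matrixP => a b; rewrite mxE.
case/mxvec_indexP: a => i j; case/mxvec_indexP: b => k l.
by rewrite !conj_mxE !mxE.
Qed.

Definition csubst g h : {mpoly A[n * n]} -> {mpoly A[n * n]} :=
  lsubst (conj_mx g h).

HB.instance Definition _ g h := GRing.RMorphism.on (csubst g h).

Lemma csubstC g h c : csubst g h c%:MP = c%:MP.
Proof. exact: lsubstC. Qed.

Lemma map_csubst_cst g h m p (M : 'M[A]_(m, p)) :
  map_mx (csubst g h) (map_mx (@mpolyC (n * n) A) M) = map_mx (@mpolyC _ A) M.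
Proof. by apply/matrixP => i j; rewrite !mxE csubstC. Qed.

Lemma map_csubst_generic g h :
  map_mx (csubst g h) X = cst g *m X *m cst h.
Proof.
apply/matrixP => i j; rewrite !mxE /csubst lsubstX.
pose E k l : {mpoly A[n * n]} :=
  conj_mx g h (mxvec_index i j) (mxvec_index k l) *: 'X_(mxvec_index k l).
rewrite (reindex _ (curry_mxvec_bij _ _)).
transitivity (\sum_p E p.1 p.2); first by apply: eq_bigr => -[].
rewrite -(pair_bigA _ E) exchange_big /=; apply: eq_bigr => l _.
rewrite [X in _ = X * _]mxE mulr_suml; apply: eq_bigr => k _.
by rewrite /E conj_mxE -mul_mpolyC mpolyCM !mxE mulrAC.
Qed.

Lemma csubstK g h g' h' : g' *m g = 1%:M -> h *m h' = 1%:M ->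
  forall F, csubst g h (csubst g' h' F) = F.
Proof.
move=> gg hh; apply: (mpoly_rmorph_ext (csubst g h \o csubst g' h') idfun).
  by move=> c; rewrite /= !csubstC.
have E : map_mx (csubst g h) (map_mx (csubst g' h') X) = X.
  rewrite map_csubst_generic !map_mxM !map_csubst_cst map_csubst_generic.
  rewrite !mulmxA -map_mxM gg -!mulmxA -map_mxM hh !map_mx1.
  by rewrite mulmx1 mul1mx.
move=> k; case/mxvec_indexP: k => i j /=.
by have := congr1 (fun M : 'M__ => M i j) E; rewrite !mxE.
Qed.

(** Conjugation by [g] on one side is compensated by the contragredient action
    on the other. *)
Lemma fischer_csubst g gi F H : g *m gi = 1%:M -> gi *m g = 1%:M ->
  fischer F H = fischer (csubst g gi F) (csubst gi^T g^T H).
Proof.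
move=> ggi gig; rewrite /csubst fischer_lsubst conj_mx_tr -/(csubst g^T gi^T _).
by rewrite csubstK // -trmx_mul ?ggi ?gig trmx1.
Qed.

End Conjugation.

Arguments csubst {A n} g h.

Section Renaming.
Variables (A : comNzRingType) (N N' : nat) (f : 'I_N' -> 'I_N).
Hypothesis f_inj : injective f.
Implicit Types (Q : {mpoly A[N]}) (F H : {mpoly A[N']}).

Definition mrename : {mpoly A[N']} -> {mpoly A[N]} :=
  mmap (@mpolyC N A) (fun i => 'X_(f i)).

HB.instance Definition _ := GRing.RMorphism.on mrename.

Lemma mrenameC c : mrename c%:MP = c%:MP.
Proof. exact: mmapC. Qed.

Lemma mrenameX i : mrename 'X_i = 'X_(f i).
Proof. by rewrite /mrename mmapX mmap1U. Qed.

Lemma mrenameZ c F : mrename (c *: F) = c *: mrename F.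
Proof. by rewrite -!mul_mpolyC rmorphM /= mrenameC. Qed.

(** The variables outside the image of [f] are set to zero; this is the adjoint
    of the renaming, see [fischer_mrename]. *)
Definition mrestrict : {mpoly A[N]} -> {mpoly A[N']} :=
  mmap (@mpolyC N' A)
    (fun k => if [pick i | f i == k] is Some i then 'X_i else 0).

HB.instance Definition _ := GRing.RMorphism.on mrestrict.

Lemma mrestrictC c : mrestrict c%:MP = c%:MP.
Proof. exact: mmapC. Qed.

Lemma mrestrictZ c Q : mrestrict (c *: Q) = c *: mrestrict Q.
Proof. by rewrite -!mul_mpolyC rmorphM /= mrestrictC. Qed.

Lemma mrestrictX i : mrestrict 'X_(f i) = 'X_i.
Proof.
rewrite /mrestrict mmapX mmap1U; case: pickP => [j /eqP/f_inj ->//|/(_ i)].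
by rewrite eqxx.
Qed.

Lemma mrestrictX0 k : (forall i, f i != k) -> mrestrict 'X_k = 0.
Proof.
move=> fk; rewrite /mrestrict mmapX mmap1U; case: pickP => // i.
by rewrite (negPf (fk i)).
Qed.

Lemma mderiv_mrename H i : (mrename H)^`M(f i) = mrename (H^`M(i)).
Proof.
apply: (mpoly_additive_ext (fun H => (mrename H)^`M(f i))
  (fun H => mrename (H^`M(i)))).
- by move=> x y; rewrite rmorphD mderivD.
- by move=> x y; rewrite mderivD rmorphD.
move=> c m; rewrite mrenameZ !mderivZ mrenameZ; congr (_ *: _).
elim/mnm_ind: m => [|k m IH].
  by rewrite mpolyX0 rmorph1 -mpolyC1 !mderivC rmorph0.
rewrite mpolyXD rmorphM /= !mderivM rmorphD !rmorphM /= IH mrenameX !mderivXU.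
by rewrite (inj_eq f_inj) rmorph_nat.
Qed.

Lemma mderiv_mrename0 H k : (forall i, f i != k) -> (mrename H)^`M(k) = 0.
Proof.
move=> fk; apply: (mpoly_additive_ext (fun H => (mrename H)^`M(k))
  (fun=> 0)).
- by move=> x y; rewrite rmorphD mderivD.
- by move=> x y; rewrite addr0.
move=> c m; rewrite mrenameZ mderivZ.
suff -> : (mrename 'X_[m])^`M(k) = 0 by rewrite scaler0.
elim/mnm_ind: m => [|l m IH].
  by rewrite mpolyX0 rmorph1 -mpolyC1 mderivC.
rewrite mpolyXD rmorphM /= mderivM IH mulr0 addr0.
by rewrite mrenameX mderivXU (negPf (fk l)) mul0r.
Qed.

Lemma fischer_mrename Q H :
  fischer Q (mrename H) = fischer (mrestrict Q) H.
Proof.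
apply: (mpoly_additive_ext (fun Q => fischer Q (mrename H))
  (fun Q => fischer (mrestrict Q) H)).
- by move=> x y; rewrite fischerDl.
- by move=> x y; rewrite rmorphD fischerDl.
move=> c m; rewrite mrestrictZ !fischerZl; congr (_ * _).
elim/mnm_ind: m H => [|k m IH] H.
  rewrite mpolyX0 rmorph1 -[1]mpolyX0 -[X in _ = fischer X _]mpolyX0.
  rewrite !fischer_coef /mfact !big1 ?mulr1 //; try by move=> i _;
    rewrite mnm0E.
  apply: (mpoly_additive_ext (fun H => (mrename H)@_0%MM) (mcoeff 0%MM)).
  - by move=> x y; rewrite rmorphD mcoeffD.
  - by move=> x y; rewrite mcoeffD.
  move=> d l; rewrite mrenameZ !mcoeffZ; congr (_ * _).
  elim/mnm_ind: l => [|i l _]; first by rewrite mpolyX0 !rmorph1.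
  rewrite mpolyXD rmorphM !rmorphM /= mrenameX !mcoeffX !mnm1_eq0.
  by rewrite !mul0r.
rewrite mpolyXD fischerXl rmorphM /=.
case: (pickP (fun i => f i == k)) => [i /eqP <-|fk].
  by rewrite mderiv_mrename IH mrestrictX fischerXl.
have {}fk i : f i != k by rewrite fk.
by rewrite mderiv_mrename0 // fischer0r mrestrictX0 // mul0r fischer0l.
Qed.

Lemma mrenameK : cancel mrename mrestrict.
Proof.
apply: (mpoly_rmorph_ext (mrestrict \o mrename) idfun) => [c|i].
  by rewrite /= mrenameC mrestrictC.
by rewrite /= mrenameX mrestrictX.
Qed.

(** A variable outside the image of the renaming can be moved to the left, where
    it differentiates [Q] alone; the others are renamed back.  The new factors
    do not depend on [F] and [H], which will be powers of varying exponent. *)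
Lemma fischer_mrename_monom m Q :
  exists (Q' : {mpoly A[N']}) (m' : 'X_{1..N'}), (mdeg m' <= mdeg m)%N /\
    forall F H,
    fischer (Q * mrename F) ('X_[m] * mrename H) =
    fischer (Q' * F) ('X_[m'] * H).
Proof.
elim/mnm_ind: m Q => [|k m IH] Q.
  exists (mrestrict Q), 0%MM; split=> [|F H]; first by rewrite !mdeg0.
  by rewrite !mpolyX0 !mul1r fischer_mrename rmorphM /= mrenameK.
rewrite mdegD mdeg1 mpolyXD.
case: (pickP (fun i => f i == k)) => [i /eqP <-|fk].
  have [Q' [m' [dm E]]] := IH Q; exists Q', (U_(i) + m')%MM.
  split=> [|F H]; first by rewrite mdegD mdeg1.
  rewrite -mrenameX (mulrC (mrename _)) -mulrA -rmorphM E mpolyXD.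
  by rewrite mulrA (mulrC 'X_[m']).
have {}fk i : f i != k by rewrite fk.
have [Q' [m' [dm E]]] := IH (Q^`M(k)); exists Q', m'; split=> [|F H].
  by rewrite (leq_trans dm) ?leq_addl.
rewrite -mulrA fischerXr mderivM [(mrename F)^`M(k)]mderiv_mrename0 //.
by rewrite mulr0 addr0 E.
Qed.

End Renaming.

Arguments mrename {A N N'} f.
Arguments mrestrict {A N N'} f.

(** * Pairing in the matrix variables only *)

Section Halves.
Variables (N1 N2 : nat).
Implicit Types (m : 'X_{1..N1 + N2}).

Definition mnm_left m : 'X_{1..N1} := [multinom m (lshift N2 i) | i < N1].
Definition mnm_right m : 'X_{1..N2} := [multinom m (rshift N1 i) | i < N2].

Lemma mnm_halves_eq m k :
  (m == k) = (mnm_left m == mnm_left k) && (mnm_right m == mnm_right k).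
Proof.
apply/eqP/andP => [->//|[/eqP/mnmP El /eqP/mnmP Er]].
apply/mnmP => i; rewrite -[ i ]splitK; case: (split i) => j /=.
  by have := El j; rewrite !mnmE.
by have := Er j; rewrite !mnmE.
Qed.

Lemma mfact_halves m : mfact m = (mfact (mnm_left m) * mfact (mnm_right m))%N.
Proof.
by rewrite /mfact big_split_ord; congr (_ * _)%N; apply: eq_bigr => i _;
  rewrite mnmE.
Qed.

Lemma mdeg_halves m : mdeg m = (mdeg (mnm_left m) + mdeg (mnm_right m))%N.
Proof.
by rewrite !mdegE big_split_ord; congr (_ + _)%N; apply: eq_bigr => i _;
  rewrite mnmE.
Qed.

(** The degree in the last [N2] variables, which will be those of the vector. *)
Definition vdeg m := mdeg (mnm_right m).

Lemma vdeg0 : vdeg 0%MM = 0%N.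
Proof. by rewrite /vdeg mdegE big1 // => i _; rewrite !mnmE. Qed.

Lemma vdegD : {morph vdeg : m k / (m + k)%MM >-> (m + k)%N}.
Proof.
move=> m k; rewrite /vdeg !mdegE -big_split; apply: eq_bigr => i _.
by rewrite !mnmE.
Qed.

HB.instance Definition _ := isMeasure.Build (N1 + N2)%N vdeg vdeg0 vdegD.

End Halves.

Arguments mnm_left {N1 N2} m.
Arguments mnm_right {N1 N2} m.

Lemma fischer_map (A B : comNzRingType) (phi : {rmorphism A -> B}) N
    (F H : {mpoly A[N]}) :
  phi (fischer F H) = fischer (map_mpoly phi F) (map_mpoly phi H).
Proof.
apply: (mpoly_biadditive_ext (fun F H => phi (fischer F H))
  (fun F H => fischer (map_mpoly phi F) (map_mpoly phi H))).
- by move=> G x y; rewrite fischerDl rmorphD.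
- by move=> G x y; rewrite fischerDr rmorphD.
- by move=> G x y; rewrite rmorphD fischerDl.
- by move=> G x y; rewrite rmorphD fischerDr.
move=> c m d k; rewrite !map_mpolyZ !map_mpolyX !fischerZl !fischerZr.
by rewrite !fischer_monom !rmorphM !rmorph_nat.
Qed.

Section Specialization.
Variables (A B : comNzRingType) (sigma : {rmorphism A -> B}) (n : nat).
Variable v : 'cV[B]_n.

(** The polynomial in the entries of the matrix that is left when the vector is
    given the value [v]. *)
Definition mspec : {mpoly A[n * n + n]} -> {mpoly B[n * n]} :=
  pteval (@mpolyC (n * n) B \o sigma) (generic_mx B n) (map_mx (@mpolyC _ B) v).

HB.instance Definition _ := GRing.RMorphism.on mspec.

Lemma mspecZ c P : mspec (c *: P) = sigma c *: mspec P.
Proof. by rewrite /mspec ptevalZ /= mul_mpolyC. Qed.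

Lemma mspecX m :
  mspec 'X_[m] = (\prod_(i < n) v i ord0 ^+ mnm_right m i) *: 'X_[mnm_left m].
Proof.
rewrite /mspec /pteval mmapX /mmap1 big_split_ord /= mulrC -mul_mpolyC.
congr (_ * _).
  rewrite rmorph_prod; apply: eq_bigr => i _; rewrite row_mxEr !mxE mnmE.
  by rewrite rmorphXn.
rewrite [RHS]mpolyXE_id; apply: eq_bigr => i _; rewrite row_mxEl mnmE.
by case/mxvec_indexP: i => i j; rewrite mxvecE mxE.
Qed.

End Specialization.

Arguments mspec {A B} sigma {n} v.

Lemma map_mspec (A B C : comNzRingType) (sigma : {rmorphism A -> B})
    (tau : {rmorphism B -> C}) n (v : 'cV[B]_n) P :
  map_mpoly tau (mspec sigma v P) = mspec (tau \o sigma) (map_mx tau v) P.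
Proof.
apply: (mpoly_rmorph_ext (map_mpoly tau \o mspec sigma v)
  (mspec (tau \o sigma) (map_mx tau v))).
  by move=> c; rewrite /= /mspec !ptevalC /= map_mpolyC.
move=> i; rewrite /= !mspecX map_mpolyZ map_mpolyX rmorph_prod; congr (_ *: _).
by apply: eq_bigr => j _; rewrite mxE rmorphXn.
Qed.

Section PartialPairing.
Variables (A : comNzRingType) (n : nat).
Notation Av := {mpoly A[n]}.
Notation K := {mpoly Av[n]}.
Implicit Types (P H : {mpoly A[n * n + n]}).

Definition cstK : A -> K := @mpolyC n Av \o @mpolyC n A.
HB.instance Definition _ := GRing.RMorphism.on cstK.

Definition vecv : 'cV[K]_n := \col_i ('X_i)%:MP.
Definition vecy : 'cV[K]_n := \col_i 'X_i.

(** The left factor keeps the inner variables for its vector and the right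
    factor the outer ones. *)
Definition partial_fischer P H : K :=
  fischer (mspec cstK vecv P) (mspec cstK vecy H).

(** The pairing of the inner variables with the outer ones, which completes
    [partial_fischer] into the full pairing. *)
Definition contract (Phi : K) : A :=
  \sum_(m <- msupp Phi) fischer Phi@_m 'X_[m].

Lemma contractwE Phi k : (msize Phi <= k)%N ->
  contract Phi = \sum_(m : 'X_{1..n < k}) fischer Phi@_m 'X_[m].
Proof.
move=> le; rewrite /contract (big_mksub 'X_{1..n < k}) /=; first last.
+ by move=> m /msize_mdeg_lt /leq_trans; apply.
+ by rewrite msupp_uniq.
by rewrite big_rmcond //= => m /memN_msupp_eq0 ->; rewrite fischer0l.
Qed.

Lemma contractD : {morph contract : x y / x + y}.
Proof.
move=> x y; pose k := maxn (msize (x + y)) (maxn (msize x) (msize y)).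
rewrite !(contractwE _ k) ?leq_max ?leqnn ?orbT // -big_split /=.
by apply: eq_bigr => m _; rewrite mcoeffD fischerDl.
Qed.

Lemma contract0 : contract 0 = 0.
Proof. by rewrite /contract msupp0 big_nil. Qed.

Lemma contract_sum (I : Type) (r : seq I) (P : pred I) (E : I -> K) :
  contract (\sum_(i <- r | P i) E i) = \sum_(i <- r | P i) contract (E i).
Proof. exact: (big_morph _ contractD contract0). Qed.

Lemma contract_term (a : Av) m : contract (a *: 'X_[m]) = fischer a 'X_[m].
Proof.
have [->|a0] := eqVneq a 0; first by rewrite scale0r contract0 fischer0l.
by rewrite /contract msuppMCX // big_seq1 mcoeffZ mcoeffX eqxx mulr1.
Qed.

Lemma contractZ c Phi : contract (cstK c * Phi) = c * contract Phi.
Proof.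
apply: (mpoly_additive_ext (fun Phi => contract (cstK c * Phi))
  (fun Phi => c * contract Phi)).
- by move=> x y; rewrite mulrDr contractD.
- by move=> x y; rewrite contractD mulrDr.
move=> a m; rewrite /cstK /= mul_mpolyC scalerA mul_mpolyC !contract_term.
by rewrite fischerZl.
Qed.

Lemma partial_fischer_term c m d k :
  partial_fischer (c *: 'X_[m]) (d *: 'X_[k]) =
  ((c * d * fischer 'X_[mnm_left m] 'X_[mnm_left k])
     *: 'X_[mnm_right m]) *: 'X_[mnm_right k].
Proof.
rewrite /partial_fischer !mspecZ !mspecX !fischerZl !fischerZr !fischer_monom.
rewrite -mul_mpolyC -[in RHS]mul_mpolyC !rmorphM !rmorph_nat.
have -> : \prod_i vecv i ord0 ^+ mnm_right m i = ('X_[mnm_right m] : Av)%:MP :>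
  K.
  rewrite mpolyXE_id rmorph_prod; apply: eq_bigr => i _.
  by rewrite mxE rmorphXn.
have -> : \prod_i vecy i ord0 ^+ mnm_right k i = 'X_[mnm_right k] :> K.
  by rewrite [RHS]mpolyXE_id; apply: eq_bigr => i _; rewrite mxE.
rewrite /cstK /=; ring.
Qed.

Lemma partial_fischerDl H : {morph partial_fischer^~ H : x y / x + y}.
Proof. by move=> x y; rewrite /partial_fischer rmorphD fischerDl. Qed.

Lemma partial_fischerDr P : {morph partial_fischer P : x y / x + y}.
Proof. by move=> x y; rewrite /partial_fischer rmorphD fischerDr. Qed.

Lemma contract_partial P H : contract (partial_fischer P H) = fischer P H.
Proof.
apply: (mpoly_biadditive_ext (fun P H => contract (partial_fischer P H))
  fischer).
- by move=> G x y; rewrite partial_fischerDl contractD.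
- by move=> G x y; rewrite partial_fischerDr contractD.
- exact: fischerDl.
- exact: fischerDr.
move=> c m d k; rewrite partial_fischer_term contract_term !fischerZl fischerZr.
rewrite !fischer_monom mnm_halves_eq mfact_halves natrM -mulnb natrM; ring.
Qed.

Lemma partial_fischer_homog P H k : H \is k.-homog for (@vdeg (n * n) n) ->
  partial_fischer P H \is k.-homog.
Proof.
move=> /dhomogP homH; rewrite [P]mpolyE [H]mpolyE.
rewrite (big_morph _ (partial_fischerDl _) (_ : _ = 0)); last first.
  by rewrite /partial_fischer rmorph0 fischer0l.
apply: rpred_sum => m _.
rewrite (big_morph _ (partial_fischerDr _) (_ : _ = 0)); last first.
  by rewrite /partial_fischer rmorph0 fischer0r.
rewrite big_seq; apply: rpred_sum => j jH; rewrite partial_fischer_term.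
by apply: dhomogZ; rewrite dhomogX /=; apply/eqP; apply: homH.
Qed.

Definition dotvy : K := \sum_i vecv i ord0 * vecy i ord0.

(** Multiplication by the inner variable of index [i] is adjoint to derivation by
    the outer one, and by Euler's identity the sum of the [d_i (y_i Phi)] is
    [(n + k) Phi]. *)
Lemma contract_dot Phi k : Phi \is k.-homog ->
  contract (dotvy * Phi) = (n + k)%:R * contract Phi.
Proof.
move=> /dhomogP homPhi; rewrite [Phi]mpolyE mulr_sumr !contract_sum mulr_sumr.
rewrite big_seq [RHS]big_seq; apply: eq_bigr => m /homPhi dm.
rewrite /dotvy mulr_suml contract_sum contract_term.
have E i : contract (vecv i ord0 * vecy i ord0 * (Phi@_m *: 'X_[m])) =
    ((m i).+1)%:R * fischer Phi@_m 'X_[m].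
  rewrite !mxE -mulrA -scalerAr mul_mpolyC scalerA -mpolyXD contract_term.
  rewrite fischerXl mderivX addmC addmK fischerZr mnmDE mnm1E eqxx addn1 //.
under eq_bigr => i _ do rewrite E.
rewrite -mulr_suml -natr_sum; congr (_%:R * _).
under eq_bigr => i _ do rewrite -addn1.
by rewrite big_split /= -mdegE dm sum1_card card_ord addnC.
Qed.

Lemma contract_dotX Phi k a : Phi \is k.-homog ->
  contract (dotvy ^+ a * Phi) = (\prod_(i < a) (n + k + i)%N)%:R * contract Phi.
Proof.
have hr : dotvy \is 1.-homog.
  apply: rpred_sum => i _; rewrite !mxE mul_mpolyC; apply: dhomogZ.
  by rewrite dhomogX /= mdeg1.
move=> hP; elim: a => [|a IH]; first by rewrite expr0 big_ord0 !mul1r.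
rewrite exprS -mulrA (contract_dot _ (a + k)); last first.
  by apply: dhomogM => //; rewrite -[X in X.-homog]mul1n; apply: dhomogMn.
by rewrite IH big_ord_recr /= (addnC a) addnA natrM mulrA [_%:R * _%:R]mulrC.
Qed.

End PartialPairing.

Arguments partial_fischer {A n} P H.
Arguments contract {A n} Phi.

(** * Moving a generic pair of vectors to the slice *)

Section Slice.
Variable n : nat.

(** The positions, in a matrix of size [1 + n], of the lower right block and of
    the rest of the first column. *)
Definition slice_index : 'I_(n * n + n) -> 'I_((1 + n) * (1 + n)) :=
  row_mx (mxvec (\matrix_(i < n, j < n) mxvec_index (rshift 1 i) (rshift 1 j)))
    (\row_(i < n) mxvec_index (rshift 1 i) (lshift n ord0)) ord0.

Lemma slice_indexM i j : slice_index (lshift n (mxvec_index i j)) =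
  mxvec_index (rshift 1 i) (rshift 1 j).
Proof. by rewrite /slice_index row_mxEl mxvecE mxE. Qed.

Lemma slice_indexv i : slice_index (rshift (n * n) i) =
  mxvec_index (rshift 1 i) (lshift n ord0).
Proof. by rewrite /slice_index row_mxEr mxE. Qed.

Lemma mxvec_index_inj m p i j k l :
  @mxvec_index m p i j = mxvec_index k l -> i = k /\ j = l.
Proof.
by move=> /cast_ord_inj/enum_rank_inj E; split; [move: E => [] | case: E].
Qed.

Lemma slice_index_inj : injective slice_index.
Proof.
move=> a b; rewrite -[a]splitK -[b]splitK.
case: (split a) => i; case: (split b) => j /=.
- case/mxvec_indexP: i => i i'; case/mxvec_indexP: j => j j'.
  by rewrite !slice_indexM => /mxvec_index_inj [] /rshift_inj -> /rshift_inj ->.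
- case/mxvec_indexP: i => i i'.
  by rewrite slice_indexM slice_indexv => /mxvec_index_inj [].
- case/mxvec_indexP: j => j j'.
  by rewrite slice_indexM slice_indexv => /mxvec_index_inj [].
by rewrite !slice_indexv => /mxvec_index_inj [] /rshift_inj ->.
Qed.

End Slice.

Section CyclicDeterminantValues.
Variables (A : fieldType) (n : nat).

Lemma pteval_cyclic (B : comNzRingType) (sigma : {rmorphism A -> B})
    (M : 'M[B]_n) (v : 'cV[B]_n) :
  pteval sigma M v (cyclic_det A n) = krylov_det M v.
Proof.
rewrite -[cyclic_det A n]/(krylov_det (gen_mx A n) (gen_vec A n)).
rewrite (krylov_det_map _ _ (pteval sigma M v)); congr krylov_det.
  by apply/matrixP => i j; rewrite !mxE /= ptevalM.
by apply/matrixP => i j; rewrite !mxE /= ptevalv [j]ord1.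
Qed.

Lemma mspec_cyclic (B : comNzRingType) (sigma : {rmorphism A -> B}) v :
  mspec sigma v (cyclic_det A n) =
  krylov_det (generic_mx B n) (map_mx (@mpolyC _ B) v).
Proof. exact: pteval_cyclic. Qed.

Lemma cyclic_det_homog : cyclic_det A n \is n.-homog for (@vdeg (n * n) n).
Proof.
have hM j : forall i k, (gen_mx A n ^+ j) i k \is 0.-homog for (@vdeg (n * n)
  n).
  elim: j => [|j IH] i k.
    by rewrite expr0 mxE; case: (_ == _); [apply: dhomog1 | apply: rpred0].
  rewrite exprS mxE; apply: rpred_sum => l _.
  apply: (@dhomogM _ _ _ 0%N _ 0%N _) => //;
    rewrite mxE dhomogX /= /vdeg mdegE big1 // => p _.
  by rewrite mnmE mnm1E eq_lrshift.
have hp (s : 'I_n -> 'I_n) : \prod_(i < n) (\matrix_(i, j) (gen_mx A n ^+ j *m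
  gen_vec A n) i ord0) i (s i)
    \is n.-homog for (@vdeg (n * n) n).
  have h1 (i : 'I_n) : (\matrix_(i, j) (gen_mx A n ^+ j *m gen_vec A n) i ord0)
    i (s i)
      \is 1.-homog for (@vdeg (n * n) n).
    rewrite !mxE; apply: rpred_sum => l _.
    apply: (@dhomogM _ _ _ 0%N _ 1%N _) => //;
      rewrite mxE dhomogX /= /vdeg mdegE (bigD1 l) //=.
    rewrite big1 ?mnmE ?mnm1E ?eqxx // => p pl.
    by rewrite mnmE mnm1E eq_rshift eq_sym (negPf pl).
  suff: \prod_(i < n) (\matrix_(i, j) (gen_mx A n ^+ j *m gen_vec A n) i ord0)
    i (s i)
      \is (\sum_(i < n) 1)%N.-homog for (@vdeg (n * n) n).
    by rewrite sum1_card card_ord.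
  elim/big_rec2: _ => [|i d p _ IH]; first exact: dhomog1.
  exact: dhomogM.
apply: rpred_sum => s _; rewrite -signr_odd mulr_sign.
by case: (odd _); rewrite ?rpredN; exact: hp.
Qed.

End CyclicDeterminantValues.

(** The columns of [g] are [v] and the basis [e_j - (y_j / y_0) e_0] of the
    hyperplane orthogonal to [y], which does not contain [v] as [y . v] is not
    zero. *)
Lemma adapted_frame (F : fieldType) n (v y : 'cV[F]_(1 + n)) r :
    y (lshift n ord0) ord0 != 0 -> r != 0 -> y^T *m v = r%:M ->
  exists2 g : 'M[F]_(1 + n), g \in unitmx &
    g *m col_mx 1%:M 0 = v /\ g^T *m y = r *: col_mx 1%:M 0.
Proof.
set y00 := y _ _ => y0 r0 yv.
have yuE : usubmx y = y00%:M.
  by apply/matrixP => i j; rewrite !ord1 !mxE eqxx.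
have yvE : (usubmx v)^T *m usubmx y + (dsubmx v)^T *m dsubmx y = r%:M.
  rewrite -[RHS]tr_scalar_mx -yv trmx_mul trmxK.
  by rewrite -{3}[v]vsubmxK -{3}[y]vsubmxK tr_col_mx mul_row_col.
pose g : 'M[F]_(1 + n) := block_mx (usubmx v) (- y00^-1 *: (dsubmx y)^T)
  (dsubmx v) 1%:M.
exists g; last first.
  split.
    by rewrite mul_block_col !mulmx0 !mulmx1 !addr0 vsubmxK.
  rewrite -{1}[y]vsubmxK tr_block_mx mul_block_col yvE.
  rewrite trmx1 mul1mx linearZ /= trmxK yuE mul_mx_scalar scalerA mulrN.
  by rewrite divff // scaleN1r addNr scale_col_mx scaler0 scalemx1.
(* Clearing the lower left block by column operations. *)
pose L : 'M[F]_(1 + n) := block_mx 1%:M 0 (- dsubmx v) 1%:M.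
have detL : \det L = 1 by rewrite det_lblock !det1 mulr1.
rewrite unitmxE unitfE -[\det g]mulr1 -detL -det_mulmx mulmx_block.
rewrite !mulmx0 !mulmx1 !add0r mul1mx mulmxN addrN det_ublock det1 mulr1.
have -> : usubmx v - - y00^-1 *: (dsubmx y)^T *m dsubmx v = (r / y00)%:M.
  rewrite -scalemxAl scaleNr opprK; have := congr1 trmx yvE.
  rewrite linearD /= !trmx_mul !trmxK yuE !tr_scalar_mx mul_scalar_mx => E.
  by rewrite [r / y00]mulrC -scale_scalar_mx -E scalerDr scalerA mulVf //
    scale1r.
by rewrite det_scalar expr1 mulf_neq0 ?invr_eq0.
Qed.

Lemma msize_lsubstX (A : idomainType) N (S : 'M[A]_N) m :
  (msize (lsubst S 'X_[m]) <= (mdeg m).+1)%N.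
Proof.
elim/mnm_ind: m => [|k m IH]; first by rewrite mpolyX0 rmorph1 msize1 mdeg0.
rewrite mpolyXD rmorphM mdegD mdeg1 /=.
have : (msize (lsubst S 'X_k) <= 2)%N.
  rewrite lsubstX; apply: leq_trans (msize_sum _ _ _) _.
  apply/bigmax_leqP => j _; apply: leq_trans (msizeZ_le _ _) _.
  by rewrite msizeX mdeg1.
have [->|p0] := eqVneq (lsubst S 'X_k) 0; first by rewrite mul0r msize0.
have [->|q0] := eqVneq (lsubst S 'X_[m]) 0; first by rewrite mulr0 msize0.
rewrite msizeM // => h; apply: leq_trans (_ : (2 + (mdeg m).+1).-1 <= _)%N =>
  //.
by rewrite -!subn1 leq_sub2r // leq_add.
Qed.

Lemma krylov_det_renamed (A : fieldType) n :
  krylov_det (generic_mx A (1 + n)) (col_mx 1%:M 0) =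
  mrename (slice_index n) (cyclic_det A n).
Proof.
rewrite krylov_det_slice.
pose phi : {rmorphism {mpoly A[n * n + n]} -> {mpoly A[(1 + n) * (1 + n)]}} :=
  mrename (slice_index n).
have E : phi (cyclic_det A n) =
    krylov_det (map_mx phi (gen_mx A n)) (map_mx phi (gen_vec A n)).
  exact: krylov_det_map.
have EM : drsubmx (generic_mx A (1 + n)) = map_mx phi (gen_mx A n).
  by apply/matrixP => i j; rewrite !mxE /= mrenameX slice_indexM.
have Ev : dlsubmx (generic_mx A (1 + n)) = map_mx phi (gen_vec A n).
  by apply/matrixP => i j; rewrite !mxE /= mrenameX slice_indexv [j]ord1.
by rewrite EM Ev; exact: esym E.
Qed.

Lemma dotvy_neq0 (A : comNzRingType) n : dotvy A (1 + n) != 0.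
Proof.
apply/eqP => /mpolyP/(_ U_(lshift n ord0)%MM);
  rewrite mcoeff0 /dotvy raddf_sum /=.
rewrite (bigD1 (lshift n ord0)) //= big1 ?addr0; last first.
  by move=> i ne; rewrite !mxE mcoeffCM mcoeffXU (negPf ne) mulr0.
rewrite !mxE mcoeffCM mcoeffX eqxx mulr1 => /mpolyP/(_ U_(lshift n ord0)%MM).
by rewrite mcoeff0 mcoeffX eqxx => /eqP; rewrite oner_eq0.
Qed.

Section SlicedPairing.
Variables (F L : fieldType) (n : nat).
Notation K := {mpoly {mpoly F[1 + n]}[1 + n]}.
Variable tau : {rmorphism K -> L}.
Hypothesis tau_inj : injective tau.
Notation N := ((1 + n) * (1 + n))%N.
Notation f := (cyclic_det F (1 + n)).
Notation f' := (mrename (slice_index n) (cyclic_det L n)).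

Notation sigma := (tau \o cstK F (1 + n)).

Lemma partial_fischer_map P H :
  tau (partial_fischer P H) =
  fischer (mspec sigma (map_mx tau (vecv F (1 + n))) P)
              (mspec sigma (map_mx tau (vecy F (1 + n))) H).
Proof.
rewrite /partial_fischer; apply: etrans (fischer_map _ _ _ _ _ _) _.
by congr fischer; apply: map_mspec.
Qed.

(** At the generic point [(v, y)], take a frame [g] adapted to it: the left factor
    is transported by [g] and the right one by its contragredient.  Then
    [f(M, v)] becomes [det g] times the smaller determinant, and [f(M, y)] becomes
    [r^(1 + n) / det g] times it, as [y] is [r] times the image of [e_1]. *)
Lemma sliced_pairing :
  exists (d rho : L)
    (Tl Tr : {rmorphism {mpoly F[N + (1 + n)]} -> {mpoly L[N]}}),
  [/\ d != 0, d * rho = tau (dotvy F (1 + n)) ^+ (1 + n),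
      Tl f = d *: f', Tr f = rho *: f' &
      (forall m, msize (Tr 'X_[m]) <= (mdeg (mnm_left m)).+1)%N /\
      forall P H, tau (partial_fischer P H) = fischer (Tl P) (Tr H)].
Proof.
pose v : 'cV[L]_(1 + n) := map_mx tau (vecv F (1 + n)).
pose y : 'cV[L]_(1 + n) := map_mx tau (vecy F (1 + n)).
pose r := tau (dotvy F (1 + n)).
have y0 : y (lshift n ord0) ord0 != 0.
  rewrite !mxE -(rmorph0 tau) (inj_eq tau_inj);
    apply/eqP => /mpolyP/(_ U_(lshift n ord0)%MM).
  by rewrite mcoeff0 mcoeffX eqxx => /eqP; rewrite oner_eq0.
have r0 : r != 0.
  by rewrite /r -(rmorph0 tau) (inj_eq tau_inj) dotvy_neq0.
have yv : y^T *m v = r%:M.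
  apply/matrixP => i j; rewrite !ord1 !mxE eqxx /r /dotvy rmorph_sum.
  by apply: eq_bigr => k _; rewrite !mxE rmorphM mulrC.
have [g ug [gv gy]] := adapted_frame _ _ _ _ _ y0 r0 yv.
have ggi := mulmxV ug; have gig := mulVmx ug; set gi := invmx g in ggi gig.
have ggiT : gi^T *m g^T = 1%:M by rewrite -trmx_mul ggi trmx1.
have gigT : g^T *m gi^T = 1%:M by rewrite -trmx_mul gig trmx1.
have dg : \det g != 0 by rewrite -unitfE -unitmxE.
have yE : y = gi^T *m (r *: col_mx 1%:M 0).
  by rewrite -gy mulmxA ggiT mul1mx.
have cste1 : map_mx (@mpolyC N L) (col_mx 1%:M 0 : 'cV_(1 + n)) = col_mx 1%:M 0.
  by rewrite map_col_mx map_mx1 map_mx0.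
pose Tl : {rmorphism {mpoly F[N + (1 + n)]} -> {mpoly L[N]}} :=
  csubst g gi \o mspec sigma v.
pose Tr : {rmorphism {mpoly F[N + (1 + n)]} -> {mpoly L[N]}} :=
  csubst gi^T g^T \o mspec sigma y.
exists (\det g), (r ^+ (1 + n) * \det gi), Tl, Tr; split=> //.
- by rewrite mulrCA -det_mulmx ggi det1 mulr1.
- rewrite /Tl /= mspec_cyclic krylov_det_map /= map_csubst_generic
  map_csubst_cst.
  rewrite -gv map_mxM cste1 krylov_det_conj;
    last by rewrite -map_mxM gig map_mx1.
  by rewrite det_map_mx mul_mpolyC krylov_det_renamed.
- rewrite /Tr /= mspec_cyclic krylov_det_map /= map_csubst_generic
  map_csubst_cst.
  rewrite yE map_mxM krylov_det_conj; last by rewrite -map_mxM gigT map_mx1.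
  rewrite map_mxZ cste1 krylov_det_scale det_map_mx det_tr krylov_det_renamed.
  by rewrite mulrA -rmorphXn -rmorphM mul_mpolyC mulrC.
split.
- move=> m; rewrite /Tr /= mspecX /csubst lsubstZ.
  exact: leq_trans (msizeZ_le _ _) (msize_lsubstX _ _ _ _).
move=> P H; rewrite partial_fischer_map.
exact: fischer_csubst.
Qed.

(** A linear relation between pairings can be checked on the slice.  As [tau] is
    injective, a relation at the generic point holds between polynomials in [v]
    and [y]; contracting it multiplies each power of the dot product, which is
    [d * rho] at the generic point, by a rising factorial. *)
Lemma contraction_principle :
  exists (d rho : L)
    (Tl Tr : {rmorphism {mpoly F[N + (1 + n)]} -> {mpoly L[N]}}),
  [/\ d != 0, rho != 0, Tl f = d *: f', Tr f = rho *: f' &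
      (forall m, msize (Tr 'X_[m]) <= (mdeg (mnm_left m)).+1)%N /\
      forall (I : Type) (s : seq I) (c : I -> F) (a k : I -> nat)
        (P H : I -> {mpoly F[N + (1 + n)]}),
      (forall i, H i \is (k i).-homog for (@vdeg N (1 + n))) ->
      \sum_(i <- s) tau (cstK F (1 + n) (c i)) *
        ((d * rho) ^+ a i * fischer (Tl (P i)) (Tr (H i))) = 0 ->
      \sum_(i <- s) c i * ((\prod_(j < (1 + n) * a i) (1 + n + k i + j)%N)%:R
        * fischer (P i) (H i)) = 0].
Proof.
have [d [rho [Tl [Tr [d0 dr Tlf Trf [Trd TP]]]]]] := sliced_pairing.
have r0 : d * rho != 0.
  rewrite dr expf_neq0 // -(rmorph0 tau) (inj_eq tau_inj); exact: dotvy_neq0.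
exists d, rho, Tl, Tr; split=> //.
  by apply: contraNneq r0 => ->; rewrite mulr0.
split=> // I s c a k P H homH Z.
pose X := \sum_(i <- s) cstK F (1 + n) (c i) *
  (dotvy F (1 + n) ^+ ((1 + n) * a i) * partial_fischer (P i) (H i)).
have X0 : X = 0.
  apply: tau_inj; apply: etrans (raddf_sum tau _ _ _) _.
  apply: etrans (esym (rmorph0 tau)); apply: etrans Z.
  apply: eq_bigr => i _.
  apply: etrans (rmorphM tau _ _) _; congr (_ * _).
  apply: etrans (rmorphM tau _ _) _; congr (_ * _); last exact: TP.
  by apply: etrans (rmorphXn tau _ _) _; rewrite exprM dr.
transitivity (contract X); last by rewrite X0 contract0.
rewrite /X contract_sum; apply: eq_bigr => i _;
  rewrite contractZ (contract_dotX _ _ _ (k i)).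
  by rewrite contract_partial.
exact: partial_fischer_homog.
Qed.

End SlicedPairing.

(** * Powers of the cyclic determinant *)

(** The value at [s = m] of the b-function, up to its leading coefficient. *)
Definition b_nat n m : nat := (\prod_(d < n.+1) \prod_(c < d) (d * m.+1 + c))%N.

Lemma b_nat0 m : b_nat 0 m = 1%N.
Proof. by rewrite /b_nat big_ord1 big_ord0. Qed.

Lemma b_natS n m : b_nat n.+1 m = (b_nat n m * \prod_(c < n.+1) (n.+1 * m.+1 +
  c))%N.
Proof. by rewrite /b_nat big_ord_recr. Qed.

(** The value of [<f^m, f^m>], see [fischer_cyclic_norm]. *)
Definition norm_nat n m : nat := (\prod_(j < m) b_nat n j)%N.

Lemma b_nat_gt0 n m : (0 < b_nat n m)%N.
Proof. by apply: prodn_gt0 => d; apply: prodn_gt0 => c;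
  case: d c => -[|d] ? []. Qed.

Lemma norm_nat_gt0 n m : (0 < norm_nat n m)%N.
Proof. by apply: prodn_gt0 => j; apply: b_nat_gt0. Qed.

Lemma fact_rising k a : (k`! * \prod_(i < a) (k.+1 + i) = (k + a)`!)%N.
Proof.
elim: a => [|a IH]; first by rewrite big_ord0 muln1 addn0.
by rewrite big_ord_recr /= mulnA IH mulnC addnS factS addSn.
Qed.

Lemma norm_natS n m :
  (n`! * norm_nat n.+1 m = norm_nat n m * (n.+1 * m + n)`!)%N.
Proof.
rewrite /norm_nat; elim: m => [|m IH];
  first by rewrite !big_ord0 muln0 mul1n muln1.
rewrite !big_ord_recr /= mulnA IH b_natS (mulnACA _ _ (b_nat n m));
  congr (_ * _)%N.
have -> : (n.+1 * m.+1 + n = n.+1 * m + n + n.+1)%N by lia.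
rewrite -[RHS]fact_rising; congr (_ * _)%N; apply: eq_bigr => c _; lia.
Qed.

Lemma cyclic_det0 (F : fieldType) : cyclic_det F 0 = 1.
Proof. exact: det_mx00. Qed.

Section ContractionStep.
Variables (F L : fieldType) (n : nat).
Notation K := {mpoly {mpoly F[1 + n]}[1 + n]}.
Variable tau : {rmorphism K -> L}.
Hypothesis tau_inj : injective tau.
Notation N := ((1 + n) * (1 + n))%N.
Notation f := (cyclic_det F (1 + n)).
Notation f0 := (cyclic_det L n).
Notation f' := (mrename (slice_index n) (cyclic_det L n)).

(** On the slice the identity in size [n] applies, and the two sides differ by one
    more factor [d * rho = r^(1 + n)] on the right; contracting it gives the new
    factors of [b_nat]. *)
Lemma fischer_cyclic_step (Q : {mpoly F[N + (1 + n)]}) m :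
    (forall Q', fischer (f0 * Q') (f0 ^+ m.+1) =
                (b_nat n m)%:R * fischer Q' (f0 ^+ m)) ->
  fischer (f * Q) (f ^+ m.+1) =
  (b_nat n.+1 m)%:R * fischer Q (f ^+ m).
Proof.
move=> IH.
have core T : fischer (f' * T) (f' ^+ m.+1) =
    (b_nat n m)%:R * fischer T (f' ^+ m).
  rewrite -!rmorphXn !fischer_mrename ?rmorphM; try exact: slice_index_inj.
  by rewrite /= mrenameK; [exact: IH | exact: slice_index_inj].
have [d [rho [Tl [Tr [d0 rho0 Tlf Trf [_ CP]]]]]] := contraction_principle F L
  n tau tau_inj.
have homf a : f ^+ a \is ((1 + n) * a).-homog for (@vdeg N (1 + n)).
  by apply: dhomogMn; apply: cyclic_det_homog.
have := CP bool [:: false; true]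
  (fun i => if i then - (b_nat n m)%:R else 1) (fun i => nat_of_bool i)
  (fun i => ((1 + n) * (if i then m else m.+1))%N)
  (fun i => if i then Q else f * Q) (fun i => f ^+ (if i then m else m.+1)).
rewrite !big_cons !big_nil !addr0 => E.
suff /E{E} : tau (cstK F (1 + n) 1) * ((d * rho) ^+ 0 *
    fischer (Tl (f * Q)) (Tr (f ^+ m.+1))) +
  tau (cstK F (1 + n) (- (b_nat n m)%:R)) * ((d * rho) ^+ 1 *
    fischer (Tl Q) (Tr (f ^+ m))) = 0.
  rewrite muln0 big_ord0 !mul1r muln1 mulNr => /(_ _)/subr0_eq ->;
    last by move=> i; apply: homf.
  rewrite mulrA -natrM b_natS; congr (_%:R * _); congr (_ * _)%N.
  by apply: eq_bigr => c _; rewrite [in RHS]mulnS.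
rewrite (rmorphM Tl f Q) (rmorphXn Tr m f) (rmorphXn Tr m.+1 f) Tlf Trf.
rewrite -scalerAl !exprZn !fischerZl !fischerZr core.
rewrite !rmorph1 (_ : tau (cstK F (1 + n) (- (b_nat n m)%:R)) = - (b_nat n
  m)%:R).
  by rewrite !exprS; ring.
by rewrite !rmorphN !rmorph_nat.
Qed.

End ContractionStep.

Lemma fraction_embedding (A : idomainType) :
  exists (L : fieldType) (tau : {rmorphism A -> L}), injective tau.
Proof.
exists {fraction A}, (@tofrac A) => x y /eqP.
by rewrite tofrac_eq => /eqP.
Qed.

Lemma bipoly_embedding (F : fieldType) n :
  exists (L : fieldType) (tau : {rmorphism {mpoly {mpoly F[n]}[n]} -> L}),
    injective tau.
Proof.
have [L [tau tau_inj]] := fraction_embedding {mpoly {mpoly F[n]}[n]}.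
by exists L, tau.
Qed.

(** The field varies along the induction: the step in size [n] uses the identity
    in the smaller size over the fractions in [v] and [y]. *)
Theorem fischer_cyclic n (F : fieldType) (Q : {mpoly F[n * n + n]}) m :
  fischer (cyclic_det F n * Q) (cyclic_det F n ^+ m.+1) =
  (b_nat n m)%:R * fischer Q (cyclic_det F n ^+ m).
Proof.
elim: n F Q => [|n IH] F Q.
  by rewrite cyclic_det0 !expr1n b_nat0 !mul1r.
have [L [tau tau_inj]] := bipoly_embedding F (1 + n).
exact: (fischer_cyclic_step F L n tau tau_inj _ _ (fun Q' => IH L Q')).
Qed.

(** * Interpolation in the exponent *)

Definition char_zero (F : fieldType) := forall k, k.+1%:R != 0 :> F.

Lemma char_zero_natr (F : fieldType) : char_zero F -> injective (fun k => k%:R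
  : F).
Proof.
move=> c0 i j; wlog ij : i j / (i <= j)%N.
  by move=> W E; case/orP: (leq_total i j) => ?; [apply: W | apply/esym/W].
move=> /eqP; rewrite eq_sym -subr_eq0 -natrB //.
case E: (j - i)%N => [|k]; last by rewrite (negPf (c0 k)).
by move=> _; apply/eqP; rewrite eqn_leq ij -subn_eq0 E.
Qed.

Lemma natr_gt0_neq0 (F : fieldType) k : char_zero F -> (0 < k)%N -> k%:R != 0
  :> F.
Proof. by case: k => // k c0 _; apply: c0. Qed.

Section Interpolation.
Variable F : fieldType.
Hypothesis F0 : char_zero F.

Definition lagrange_nat e j : {poly F} :=
  \prod_(i < e | i != j :> nat) ((j%:R - i%:R)^-1 *: ('X - (i%:R)%:P)).

Lemma size_lagrange_nat e j : (j < e)%N -> (size (lagrange_nat e j) <= e)%N.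
Proof.
move=> je; apply: leq_trans (size_prod_leq _ _) _.
pose jo := Ordinal je.
have cP : #|[pred i : 'I_e | i != j :> nat]| = e.-1.
  have := cardC1 jo; rewrite card_ord => <-; apply: eq_card => i.
  by rewrite !inE.
apply: leq_trans (_ : (\sum_(i < e | i != j :> nat) 2).+1 - e.-1 <= _)%N.
  rewrite cP leq_sub2r // ltnS; apply: leq_sum => i _.
  by apply: leq_trans (size_scale_leq _ _) _; rewrite size_XsubC.
by rewrite sum_nat_const cP; lia.
Qed.

Lemma lagrange_natE e j k : (j < e)%N -> (k < e)%N ->
  (lagrange_nat e j).[k%:R] = (j == k)%:R.
Proof.
move=> je ke; rewrite /lagrange_nat horner_prod.
have [<-|jk] := eqVneq j k.
  rewrite big1 // => i ij; rewrite !hornerE mulVf // subr_eq0.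
  by rewrite (inj_eq (char_zero_natr _ F0)) eq_sym.
rewrite (bigD1 (Ordinal ke)) /=; last by rewrite eq_sym.
by rewrite !hornerE subrr mulr0 mul0r.
Qed.

(** The coefficients of the interpolation formula come from [F] even when [q] has
    coefficients in a larger field. *)
Lemma nat_interpolation (L : fieldType) (sigma : {rmorphism F -> L}) (q : {poly
  L}) e x :
  (size q <= e)%N ->
  q.[x%:R] = \sum_(j < e) q.[j%:R] * sigma (lagrange_nat e j).[x%:R].
Proof.
move=> sq; pose p := \sum_(j < e) q.[j%:R] *: map_poly sigma (lagrange_nat e j).
have hp y : p.[y%:R] = \sum_(j < e) q.[j%:R] * sigma (lagrange_nat e j).[y%:R].
  rewrite horner_sum; apply: eq_bigr => j _.
  by rewrite hornerZ -horner_map /= rmorph_nat.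
have L0 : char_zero L.
  by move=> k; rewrite -(rmorph_nat sigma) fmorph_eq0.
rewrite -hp; suff : q - p == 0 by rewrite subr_eq0 => /eqP <-.
apply: contraT => qp.
have := max_poly_roots qp (rs := [seq j%:R | j <- iota 0 e]).
rewrite size_map size_iota => /(_ _ _) H.
have : (e < size (q - p)%R)%N.
  apply: H; last first.
    by rewrite map_inj_uniq ?iota_uniq //; apply: char_zero_natr.
  apply/allP => z /mapP[k]; rewrite mem_iota add0n => /andP[_ ke] ->.
  rewrite rootE hornerD hornerN hp (bigD1 (Ordinal ke)) //= big1 => [|j jk].
    by rewrite lagrange_natE // eqxx rmorph1 mulr1 addr0 subrr.
  by rewrite lagrange_natE // (negPf (_ : j != k :> nat)) ?rmorph0 ?mulr0.
rewrite ltnNge (leq_trans (size_polyD _ _)) // geq_max sq size_polyN.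
apply: leq_trans (size_sum _ _ _) _; apply/bigmax_leqP => j _.
apply: leq_trans (size_scale_leq _ _) _.
by rewrite size_map_poly size_lagrange_nat.
Qed.

End Interpolation.

Section PolynomialMultiples.
Variable F : fieldType.
Implicit Types (w h : nat -> F).

(** The degree bound is part of the definition because interpolation needs one
    that is uniform over the generic points. *)
Definition poly_multiple w e h :=
  exists2 q : {poly F}, (size q <= e)%N & forall m, h m = w m * q.[m%:R].

Lemma poly_multiple0 w e : poly_multiple w e (fun=> 0).
Proof. by exists 0 => [|m]; rewrite ?size_poly0 // horner0 mulr0. Qed.

Lemma poly_multipleD w e h1 h2 : poly_multiple w e h1 -> poly_multiple w e h2 ->
  poly_multiple w e (fun m => h1 m + h2 m).
Proof.
move=> [q1 s1 E1] [q2 s2 E2]; exists (q1 + q2) => [|m].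
  by rewrite (leq_trans (size_polyD _ _)) // geq_max s1 s2.
by rewrite E1 E2 hornerD mulrDr.
Qed.

Lemma poly_multipleZ w e c h : poly_multiple w e h ->
  poly_multiple w e (fun m => c * h m).
Proof.
move=> [q s E]; exists (c *: q) => [|m].
  by rewrite (leq_trans (size_scale_leq _ _)).
by rewrite E hornerZ mulrCA.
Qed.

Lemma eq_poly_multiple w e h1 h2 : h1 =1 h2 ->
  poly_multiple w e h1 -> poly_multiple w e h2.
Proof. by move=> E [q s Eq]; exists q => // m; rewrite -E. Qed.

Lemma poly_multiple_sum w e (I : eqType) (r : seq I) (h : I -> nat -> F) :
    (forall i, i \in r -> poly_multiple w e (h i)) ->
  poly_multiple w e (fun m => \sum_(i <- r) h i m).
Proof.
elim: r => [|i r IH] H.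
  by apply: eq_poly_multiple (poly_multiple0 w e) => m; rewrite big_nil.
apply: (eq_poly_multiple _ _ (fun m => h i m + \sum_(i <- r) h i m)).
  by move=> m; rewrite big_cons.
apply: poly_multipleD; first by apply: H; rewrite mem_head.
by apply: IH => j jr; apply: H; rewrite in_cons jr orbT.
Qed.

End PolynomialMultiples.

Arguments poly_multiple {F} w e h.
Arguments eq_poly_multiple {F w e} h1 h2.

(** A bound in terms of the degree of [P] alone is uniform over the adapted
    frames, which transform both [P] and [Q] but preserve the degree of [P]. *)
Definition pairing_quotients_poly n D := forall (F : fieldType), char_zero F ->
  forall P Q : {mpoly F[n * n + n]}, (msize P <= D.+1)%N ->
  poly_multiple (fun m => (norm_nat n m.+1)%:R) (n * D).+1
    (fun m => fischer (Q * cyclic_det F n ^+ m) (P * cyclic_det F n ^+ m.+1)).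

(** * Polynomiality of the quotient of pairings *)

Section DivisibilityStep.
Variables (F L : fieldType) (n : nat).
Notation K := {mpoly {mpoly F[1 + n]}[1 + n]}.
Variable tau : {rmorphism K -> L}.
Hypothesis tau_inj : injective tau.
Hypothesis F0 : char_zero F.
Hypothesis IH : forall D, pairing_quotients_poly n D.
Notation N := ((1 + n) * (1 + n))%N.
Notation f := (cyclic_det F (1 + n)).
Notation f0 := (cyclic_det L n).
Notation f' := (mrename (slice_index n) (cyclic_det L n)).
Notation sigma := (tau \o cstK F (1 + n)).

Lemma char_zero_ext : char_zero L.
Proof. by move=> k; rewrite -(rmorph_nat sigma) fmorph_eq0. Qed.

Lemma pairing_quotient_slice D (T1 T2 : {mpoly L[N]}) : (msize T2 <= D.+1)%N ->
  poly_multiple (fun m => (norm_nat n m.+1)%:R) (n * D).+1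
    (fun m => fischer (T1 * f' ^+ m) (T2 * f' ^+ m.+1)).
Proof.
move=> sT; apply: (eq_poly_multiple (fun m => \sum_(mu <- msupp T2)
    T2@_mu * fischer (T1 * f' ^+ m) ('X_[mu] * f' ^+ m.+1))).
  move=> m; rewrite [in RHS](mpolyE T2) mulr_suml fischer_sumr.
  by apply: eq_bigr => mu _; rewrite -scalerAl fischerZr.
apply: poly_multiple_sum => mu muT; apply: poly_multipleZ.
have [Q' [mu' [dmu E]]] :=
  fischer_mrename_monom _ _ _ _ (slice_index_inj n) mu T1.
have sX : (msize ('X_[mu'] : {mpoly L[n * n + n]}) <= D.+1)%N.
  rewrite msizeX ltnS (leq_trans dmu) // -ltnS.
  exact: leq_trans (msize_mdeg_lt muT) sT.
apply: eq_poly_multiple (IH D L char_zero_ext 'X_[mu'] Q' sX) => m.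
by rewrite -!rmorphXn E.
Qed.

Lemma size_linear_prod (a b : nat -> F) p :
  (size (\prod_(i < p) (a i *: 'X + (b i)%:P))%R <= p.+1)%N.
Proof.
apply: leq_trans (size_prod_leq _ _) _; rewrite card_ord.
apply: leq_trans (_ : (\sum_(i < p) 2).+1 - p <= _)%N.
  rewrite leq_sub2r // ltnS; apply: leq_sum => i _.
  rewrite (leq_trans (size_polyD _ _)) // geq_max (leq_trans (size_scale_leq _
    _)).
    by rewrite (leq_trans (size_polyC_leq1 _)).
  by rewrite size_polyX.
by rewrite sum_nat_const card_ord; lia.
Qed.

(** With [I m] the pairing in question, the induction hypothesis bounds the degree
    in [m] of its sliced version, so that the latter satisfies an interpolation
    relation in [m] with coefficients in [F].  By [contraction_principle] the
    same relation holds for [I m], up to the factorials produced by the powers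
    of [r], and it exhibits the quotient as a polynomial. *)
Lemma pairing_quotient_step_monom D Q mu : (mdeg mu <= D)%N ->
  poly_multiple (fun m => (norm_nat n.+1 m.+1)%:R) (n.+1 * D).+1
    (fun m => fischer (Q * f ^+ m) ('X_[mu] * f ^+ m.+1)).
Proof.
move=> dmu.
have [d [rho [Tl [Tr [d0 rho0 Tlf Trf [sTr CP]]]]]] :=
  contraction_principle F L n tau tau_inj.
pose D' := mdeg (mnm_left mu); pose p := mdeg (mnm_right mu).
have Dp : (D' + p <= D)%N by rewrite -mdeg_halves.
have [q sq Eq] := pairing_quotient_slice D' (Tl Q) (Tr 'X_[mu]) (sTr mu).
pose e := (n * D').+1; rewrite -/e in sq.
pose k m := ((1 + n) * m.+1 + p)%N.
pose I m := fischer (Q * f ^+ m) ('X_[mu] * f ^+ m.+1).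
have homH m : 'X_[mu] * f ^+ m.+1 \is (k m).-homog for (@vdeg N (1 + n)).
  rewrite /k [(_ + p)%N]addnC; apply: dhomogM; first by rewrite dhomogX.
  by apply: dhomogMn; apply: cyclic_det_homog.
have pair m : fischer (Tl (Q * f ^+ m)) (Tr ('X_[mu] * f ^+ m.+1)) =
    d^-1 * (d * rho) ^+ m.+1 * ((norm_nat n m.+1)%:R * q.[m%:R]).
  rewrite (rmorphM Tl Q) (rmorphM Tr 'X_[mu]) (rmorphXn Tl m f).
  rewrite (rmorphXn Tr m.+1 f) Tlf Trf !exprZn -!scalerAr fischerZl fischerZr.
  rewrite Eq exprMn [d ^+ m.+1]exprS !mulrA mulVf // mul1r; ring.
have NF m : (norm_nat n m)%:R != 0 :> F.
  by apply: natr_gt0_neq0 F0 (norm_nat_gt0 _ _).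
have aF m : (m`!)%:R != 0 :> F by apply: natr_gt0_neq0 F0 (fact_gt0 _).
pose q2 : {poly F} := \sum_(j < e)
  (I j / ((norm_nat n j.+1)%:R * (n + k j)`!%:R)) *: lagrange_nat F e j.
have Iq2 m : I m = (norm_nat n m.+1)%:R * (n + k m)`!%:R * q2.[m%:R].
  (* The index [None] stands for the exponent [m] and [Some j] for the node
     [j]; the powers of [r] are adjusted to have the same total exponent. *)
  pose c (i : option 'I_e) : F := if i is Some j
    then - ((norm_nat n m.+1)%:R / (norm_nat n j.+1)%:R * (lagrange_nat F e
      j).[m%:R])
    else 1.
  pose a (i : option 'I_e) := if i is Some j then (m + e - j)%N else e.
  pose g (i : option 'I_e) : nat := if i is Some j then j else m.
  have := CP _ (None :: [seq Some j | j <- index_enum 'I_e]) c a (k \o g)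
    (fun i => Q * f ^+ g i) (fun i => 'X_[mu] * f ^+ (g i).+1).
  rewrite !big_cons !big_map => /(_ (fun i => homH (g i))) H.
  set R := d * rho in H.
  have NL j : (norm_nat n j)%:R != 0 :> L.
    by apply: natr_gt0_neq0 char_zero_ext (norm_nat_gt0 _ _).
  have Z : tau (cstK F (1 + n) (c None)) * (R ^+ a None * fischer
        (Tl (Q * f ^+ g None)) (Tr ('X_[mu] * f ^+ (g None).+1))) +
      \sum_(j < e) tau (cstK F (1 + n) (c (Some j))) * (R ^+ a (Some j) *
        fischer (Tl (Q * f ^+ g (Some j))) (Tr ('X_[mu] * f ^+ (g (Some
          j)).+1))) = 0.
    apply/eqP; rewrite addr_eq0 -sumrN; apply/eqP; rewrite /a /g.
    pose s j := sigma (lagrange_nat F e j).[m%:R].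
    have qE : q.[m%:R] = \sum_(j < e) q.[j%:R] * s j.
      exact: nat_interpolation F F0 L sigma q e m sq.
    have cE (j : 'I_e) : tau (cstK F (1 + n) (c (Some j))) =
        - ((norm_nat n m.+1)%:R / (norm_nat n j.+1)%:R * s j).
      rewrite /c -[tau _]/(sigma _) rmorphN !rmorphM fmorphV.
      by rewrite (rmorph_nat sigma (norm_nat n m.+1)) (rmorph_nat sigma).
    have c1 : tau (cstK F (1 + n) (c None)) = 1 by rewrite /c !rmorph1.
    rewrite c1 (pair m) qE -/R.
    rewrite !mulr_sumr; apply: eq_bigr => j _; rewrite cE (pair j) -/R.
    have RE : R ^+ (m + e - j) * R ^+ j.+1 = R ^+ e * R ^+ m.+1.
      by rewrite -!exprD; congr (_ ^+ _); have := ltn_ord j; lia.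
    move: (NL j.+1) RE.
    move: (s j) (norm_nat n j.+1)%:R (norm_nat n m.+1)%:R q.[j%:R].
    move: (R ^+ (m + e - j)) (R ^+ j.+1) (R ^+ e) (R ^+ m.+1) d^-1.
    move=> Ra Rj Re Rm di sj Nj Nm qj Nj0 RE.
    transitivity (Nm * sj * di * qj * (Ra * Rj)); first by rewrite RE; ring.
    by field.
  have {H Z} := H Z; rewrite /c /a /g /= mul1r => /eqP;
    rewrite addr_eq0 => /eqP H.
  pose W := (n + k m + (1 + n) * e)`!.
  have WF : W%:R != 0 :> F by apply: aF.
  apply: (mulfI WF).
  have -> : W%:R * I m = (n + k m)`!%:R *
     ((\prod_(j < (1 + n) * e) (1 + n + k m + j))%N%:R * I m).
    rewrite mulrA -natrM; congr (_%:R * _); symmetry.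
    exact: (fact_rising (n + k m) ((1 + n) * e)).
  rewrite H -sumrN /q2 horner_sum !mulr_sumr; apply: eq_bigr => j _.
  have -> : W = ((n + k j)`! * \prod_(i < (1 + n) * (m + e - j)) (1 + n + k j +
    i))%N.
    apply: etrans (esym (fact_rising (n + k j) _)); rewrite /W /k; congr _`!.
    move: (nat_of_ord j) (ltn_ord j) => j' /ltnW/subnKC.
    by move: (e - j')%N => t <-; rewrite (_ : m + (j' + t) - j' = m + t)%N; lia.
  rewrite hornerZ natrM -/(I j).
  move: (NF j.+1) (aF (n + k j)%N).
  move: (norm_nat n j.+1)%:R (norm_nat n m.+1)%:R (n + k j)`!%:R (n + k m)`!%:R.
  move: (\prod_(i < _) _)%N%:R (I j) (lagrange_nat F e j).[_].
  by move=> A B C Nj Nm x y Nj0 x0; field; rewrite Nj0 x0.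
pose pp : {poly F} := \prod_(i < p) (n.+1%:R *: 'X + ((n.+1 + n.+1 +
  i)%N%:R)%:P).
exists (n`!%:R *: (pp * q2)) => [|m].
  rewrite (leq_trans (size_scale_leq _ _)) // (leq_trans (size_polyMleq _ _))
    //.
  have sp : (size pp <= p.+1)%N.
    exact: (size_linear_prod (fun=> n.+1%:R) (fun i => (n.+1 + n.+1 + i)%N%:R)).
  have s2 : (size q2 <= e)%N.
    apply: leq_trans (size_sum _ _ _) _; apply/bigmax_leqP => j _.
    by rewrite (leq_trans (size_scale_leq _ _)) // size_lagrange_nat.
  have nD : (n * D' <= n * D)%N by rewrite leq_mul2l (leq_trans _ Dp) ?leq_addr
    ?orbT.
  move: sp s2; rewrite /e mulSn; set x := size pp; set y := size q2.
  by move: Dp nD; lia.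
rewrite -/(I m) Iq2 hornerZ hornerM !mulrA; congr (_ * _).
have -> : pp.[m%:R] = (\prod_(i < p) ((n.+1 * m.+1 + n).+1 + i))%N%:R.
  rewrite horner_prod natr_prod; apply: eq_bigr => i _.
  by rewrite !hornerE -natrM -natrD; congr _%:R; lia.
rewrite -!natrM; congr _%:R.
have -> : (n + k m = n.+1 * m.+1 + n + p)%N by rewrite /k; lia.
by rewrite -fact_rising mulnA -norm_natS (mulnC n`!).
Qed.

Lemma pairing_quotient_step D (P Q : {mpoly F[N + (1 + n)]}) : (msize P <=
  D.+1)%N ->
  poly_multiple (fun m => (norm_nat n.+1 m.+1)%:R) (n.+1 * D).+1
    (fun m => fischer (Q * f ^+ m) (P * f ^+ m.+1)).
Proof.
move=> sP; apply: (eq_poly_multiple (fun m => \sum_(mu <- msupp P)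
    P@_mu * fischer (Q * f ^+ m) ('X_[mu] * f ^+ m.+1))).
  move=> m; rewrite [in RHS](mpolyE P) mulr_suml fischer_sumr.
  by apply: eq_bigr => mu _; rewrite -scalerAl fischerZr.
apply: poly_multiple_sum => mu muP; apply: poly_multipleZ.
by apply: pairing_quotient_step_monom; rewrite -ltnS;
  apply: leq_trans (msize_mdeg_lt muP) sP.
Qed.

End DivisibilityStep.

Theorem pairing_quotient_poly n D : pairing_quotients_poly n D.
Proof.
elim: n D => [|n IH] D F F0 P Q sP.
  exists (fischer Q P)%:P; first exact: size_polyC_leq1.
  move=> m; rewrite cyclic_det0 !expr1n !mulr1 hornerC /norm_nat big1 ?mul1r //.
  by move=> i _; apply: b_nat0.
have [L [tau tau_inj]] := bipoly_embedding F (1 + n).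
exact: (pairing_quotient_step F L n tau tau_inj F0 IH D P Q sP).
Qed.

(** * Evaluating the formal exponent at integers *)

Section SpecializationOfS.
Variables (C : fieldType) (N : nat).
Notation PS := {mpoly {poly C}[N]}.

Definition mspecialize m : PS -> {mpoly C[N]} :=
  map_mpoly (horner_eval (m%:R : C)).

HB.instance Definition _ m := GRing.RMorphism.on (mspecialize m).

Lemma mspecialize_coef m (R : PS) mu : (mspecialize m R)@_mu = (R@_mu).[m%:R].
Proof. by rewrite /mspecialize mcoeff_map_mpoly. Qed.

Lemma mspecialize_lift m (p : {mpoly C[N]}) : mspecialize m (map_mpoly polyC p)
  = p.
Proof.
by apply/mpolyP => mu; rewrite mspecialize_coef mcoeff_map_mpoly /= hornerC.
Qed.

Lemma mspecializeC m (b : {poly C}) : mspecialize m b%:MP = (b.[m%:R])%:MP.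
Proof. by rewrite /mspecialize map_mpolyC. Qed.

Lemma mspecialize_deriv m i (R : PS) : mspecialize m (R^`M(i)) = (mspecialize m
  R)^`M(i).
Proof.
apply/mpolyP => mu; rewrite mspecialize_coef !mcoeff_mderiv mspecialize_coef.
by rewrite hornerMn.
Qed.

Hypothesis C0 : char_zero C.

Lemma poly_eq0_large_nat (p : {poly C}) k :
  (forall m, (k <= m)%N -> p.[m%:R] = 0) -> p = 0.
Proof.
move=> H; apply/eqP; apply: contraT => p0.
have := max_poly_roots p0 (rs := [seq j%:R | j <- iota k (size p)]).
rewrite size_map size_iota ltnn => X; apply: X.
  by apply/allP => z /mapP[j]; rewrite mem_iota => /andP[kj _] ->;
    rewrite rootE H.
by rewrite map_inj_uniq ?iota_uniq //; apply: char_zero_natr.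
Qed.

Lemma mspecialize_eq0 (R : PS) k :
  (forall m, (k <= m)%N -> mspecialize m R = 0) -> R = 0.
Proof.
move=> H; apply/mpolyP => mu; rewrite mcoeff0.
by apply: (poly_eq0_large_nat _ k) => m km;
  rewrite -mspecialize_coef H ?mcoeff0.
Qed.

End SpecializationOfS.

Arguments mspecialize {C N} m.
Arguments mspecialize_lift {C N} m p.

Lemma mderiv_exp (A : comNzRingType) N i (p : {mpoly A[N]}) k :
  (p ^+ k)^`M(i) * p = k%:R * p ^+ k * p^`M(i).
Proof.
elim: k => [|k IH]; first by rewrite expr0 -mpolyC1 mderivC !mul0r.
rewrite exprS mderivM mulrDl -(mulrA p) IH -natr1; ring.
Qed.

(** The derivative of [R / G] times [P^s], with [G] a power of [P] of exponent
    [k]. *)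
Lemma log_derivative_identity (L : fieldType) (R R' G G' P P' s k : L) :
    P != 0 -> G != 0 -> G' * P = k * G * P' ->
  (R' * G - R * G') / G ^+ 2 + R / G * (s * P' / P) =
  (R' * P + (s - k) * (R * P')) / (P * G).
Proof.
move=> P0 G0 E; have -> : G' = k * G * P' / P by rewrite -E mulfK.
by field; rewrite P0 G0.
Qed.

Section FamilySpecialization.
Variables (C : fieldType) (N : nat) (f : {mpoly C[N]}).
Hypothesis C0 : char_zero C.
Hypothesis f0 : f != 0.
Notation PS := {mpoly {poly C}[N]}.
Notation fl := (map_mpoly polyC f : PS).
Notation sp := mspecialize.
Implicit Types (g : fs_mod C N) (h : nat -> {mpoly C[N]}).

(** For large [m], [h m] is the value at [s = m] of [g f^s]; only large [m] count
    because of the denominator of [g]. *)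
Definition specializes g h := exists (k : nat) (R : PS),
  g = R%:F / (fl ^+ k)%:F /\
  forall m, (k <= m)%N -> h m = sp m R * f ^+ (m - k).

Lemma lift_neq0 : fl != 0.
Proof.
apply: contraNneq f0 => E; rewrite -(mspecialize_lift 0 f) E.
by rewrite rmorph0.
Qed.

Lemma liftX_neq0 k : (fl ^+ k)%:F != 0.
Proof. by rewrite tofrac_eq0 expf_neq0 ?lift_neq0. Qed.

Lemma specializes_poly (R : PS) h :
  (forall m, h m = sp m R * f ^+ m) -> specializes R%:F h.
Proof.
move=> H; exists 0%N, R; split; last by move=> m _; rewrite subn0.
by rewrite expr0 tofrac1 divr1.
Qed.

Lemma specializesM (p : PS) g h : specializes g h ->
  specializes (p%:F * g) (fun m => sp m p * h m).
Proof.
move=> [k [R [-> H]]]; exists k, (p * R); split.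
  by rewrite mulrA -tofracM.
by move=> m km; rewrite (H m km) rmorphM mulrA.
Qed.

Lemma specializesD g h g' h' : specializes g h -> specializes g' h' ->
  specializes (g + g') (fun m => h m + h' m).
Proof.
move=> [k [R [-> H]]] [k' [R' [-> H']]].
exists (k + k')%N, (R * fl ^+ k' + R' * fl ^+ k); split.
  rewrite addf_div ?liftX_neq0 //.
  by rewrite -!tofracM -tofracD -exprD.
move=> m km; have km1 : (k <= m)%N by apply: leq_trans km; apply: leq_addr.
have km2 : (k' <= m)%N by apply: leq_trans km; apply: leq_addl.
rewrite (H m km1) (H' m km2) rmorphD !rmorphM !rmorphXn /= mspecialize_lift.
rewrite mulrDl -!mulrA -!exprD; congr (_ * _ ^+ _ + _ * _ ^+ _); lia.
Qed.

Lemma specializes_sum (I : Type) (r : seq I) (g : I -> fs_mod C N)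
    (h : I -> nat -> {mpoly C[N]}) :
  (forall i, specializes (g i) (h i)) ->
  specializes (\sum_(i <- r) g i) (fun m => \sum_(i <- r) h i m).
Proof.
move=> H; elim: r => [|i r IH].
  rewrite big_nil -tofrac0; apply: specializes_poly => m.
  by rewrite big_nil rmorph0 mul0r.
have [k [R [E E']]] := specializesD _ _ _ _ (H i) IH.
exists k, R; split; first by rewrite big_cons.
by move=> m km; rewrite big_cons E'.
Qed.

Lemma specializes_deriv i g h : specializes g h ->
  specializes (fs_deriv f i g) (fun m => (h m)^`M(i)).
Proof.
move=> [k [R [-> H]]].
exists k.+1, (R^`M(i) * fl + (('X : {poly C})%:MP - k%:R) * (R * fl^`M(i)));
  split.
  rewrite /fs_deriv frac_deriv_div ?expf_neq0 ?lift_neq0 //.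
  have -> : fs_of (f^`M(i)) = (fl^`M(i))%:F.
    rewrite /fs_of; congr (_%:F); apply/mpolyP => mu.
    by rewrite mcoeff_map_mpoly !mcoeff_mderiv mcoeff_map_mpoly /= polyCMn.
  have -> : fs_of f = fl%:F by [].
  have -> : fs_scalar N 'X = (('X : {poly C})%:MP_[N])%:F by [].
  rewrite (tofracXn 2 (fl ^+ k)) (tofracB (_ * _)) (tofracM R^`M(i)) (tofracM
    R).
  rewrite (exprS fl) (tofracM fl) (tofracD (_ * _)) (tofracM R^`M(i)) (tofracM
    (_ - _)).
  rewrite (tofracB _%:MP) (tofracM R (fl^`M(i))).
  apply: log_derivative_identity.
  - by rewrite tofrac_eq0 lift_neq0.
  - exact: liftX_neq0.
  - by rewrite -!tofracM mderiv_exp.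
move=> m km; have km' := ltnW km; rewrite (H m km').
rewrite rmorphD !rmorphM rmorphB /= !mspecialize_deriv mspecialize_lift
  mspecializeC.
rewrite hornerX !rmorph_nat mderivM.
have -> : (m - k = (m - k.+1).+1)%N by lia.
have -> : m%:R - k%:R = (m - k.+1).+1%:R :> {mpoly C[N]}.
  by rewrite -natrB //; congr _%:R; lia.
have E : (f ^+ (m - k.+1).+1)^`M(i) = (m - k.+1).+1%:R * f ^+ (m - k.+1) *
  f^`M(i).
  elim: (m - k.+1)%N => [|l IHl]; first by rewrite expr1 expr0 !mul1r.
  by rewrite exprS mderivM IHl -[in RHS]natr1 exprS; ring.
by rewrite E exprS; ring.
Qed.

Lemma specializes_derivm mu g h : specializes g h ->
  specializes (fs_derivm f mu g) (fun m => (h m)^`M[mu]).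
Proof.
rewrite /fs_derivm /mderivm => H; elim: (enum _) => [|i s IH]; first exact: H.
change (specializes
  (iter (mu i) (fs_deriv f i) (foldr (fun i => iter (mu i) (fs_deriv f i)) g s))
  (fun m => iter (mu i) (mderiv i)
              (foldr (fun i => iter (mu i) (mderiv i)) (h m) s))).
elim: (mu i) => [|l IHl]; first exact: IH.
exact: specializes_deriv IHl.
Qed.

Lemma specializes_eq g h g' h' M : specializes g h -> specializes g' h' ->
  (forall m, (M <= m)%N -> h m = h' m) -> g = g'.
Proof.
move=> [k [R [-> H]]] [k' [R' [-> H']]] E.
suff Z : R * fl ^+ k' - R' * fl ^+ k = 0.
  apply/eqP; rewrite eqr_div ?liftX_neq0 // -!tofracM tofrac_eq -subr_eq0.
  by rewrite Z eqxx.
apply: (mspecialize_eq0 _ _ C0 _ (maxn M (maxn k k'))) => m.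
rewrite !geq_max => /and3P[Mm km km']; apply/eqP.
rewrite rmorphB !rmorphM !rmorphXn /= mspecialize_lift subr_eq0.
have fm0 : f ^+ (m - k + (m - k')) != 0 by apply: expf_neq0.
rewrite -(inj_eq (mulIf fm0)); apply/eqP.
have := E m Mm; rewrite (H m km) (H' m km');
  move: (sp m R) (sp m R') => r r' {}E.
transitivity ((r * f ^+ (m - k)) * f ^+ m).
  rewrite -!mulrA -!exprD; congr (_ * _ ^+ _); lia.
rewrite E -!mulrA -!exprD; congr (_ * _ ^+ _); lia.
Qed.

Lemma specializes_inj g h h' : specializes g h -> specializes g h' ->
  exists M, forall m, (M <= m)%N -> h m = h' m.
Proof.
move=> [k [R [-> H]]] [k' [R' [/eqP E H']]].
exists (maxn k k') => m; rewrite geq_max => /andP[km km'].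
move: E; rewrite eqr_div ?liftX_neq0 // -!tofracM tofrac_eq => /eqP.
move=> /(congr1 (sp m)); rewrite !rmorphM !rmorphXn /= mspecialize_lift.
rewrite (H m km) (H' m km'); move: (sp m R) (sp m R') => r r' E.
apply: (mulIf (expf_neq0 (k + k') f0)).
transitivity ((r * f ^+ k') * f ^+ m).
  rewrite -!mulrA -!exprD; congr (_ * _ ^+ _); lia.
rewrite E -!mulrA -!exprD; congr (_ * _ ^+ _); lia.
Qed.

End FamilySpecialization.

Arguments specializes {C N} f g h.

(** * The b-function *)

Lemma fischer_nondegenerate (F : fieldType) N (H : {mpoly F[N]}) :
  char_zero F -> (forall Q, fischer Q H = 0) -> H = 0.
Proof.
move=> F0 Z; apply/mpolyP => m; rewrite mcoeff0; apply/eqP.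
have := Z 'X_[m]; rewrite fischer_coef => /eqP; rewrite mulf_eq0 orbC.
have /negPf -> // : (mfact m)%:R != 0 :> F.
by apply: natr_gt0_neq0 => //; apply: prodn_gt0 => i; apply: fact_gt0.
Qed.

Section BFunctionOfCyclicDeterminant.
Variables (C : fieldType) (n : nat).
Hypothesis C0 : char_zero C.
Notation N := (n * n + n)%N.
Notation f := (cyclic_det C n).
Notation PS := {mpoly {poly C}[N]}.
Notation sp := mspecialize.

Lemma fischer_cyclic_norm m : fischer (f ^+ m) (f ^+ m) = (norm_nat n m)%:R.
Proof.
elim: m => [|m IH].
  rewrite !expr0 -[X in fischer X _]mpolyX0 fischer_coef /norm_nat /mfact.
  rewrite !big1 ?mulr1 ?mcoeff1 ?eqxx // => i _.
    by case: i.
  by rewrite mnm0E.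
by rewrite {1}exprS fischer_cyclic IH /norm_nat big_ord_recr /= natrM mulrC.
Qed.

Lemma cyclic_det_neq0 : f != 0.
Proof.
apply/eqP => E; have := fischer_cyclic_norm 1;
  rewrite E expr1 fischer0l => /esym/eqP.
by rewrite (negPf (natr_gt0_neq0 _ _ C0 (norm_nat_gt0 _ _))).
Qed.

(** Paired with an arbitrary [Q], the left side is [<f Q, f^(m+1)>]. *)
Lemma cyclic_capelli m :
  \sum_(mu <- msupp f) f@_mu *: (f ^+ m.+1)^`M[mu] = (b_nat n m)%:R *: f ^+ m.
Proof.
apply/eqP; rewrite -subr_eq0; apply/eqP; apply: fischer_nondegenerate => // Q.
rewrite -scaleN1r fischerDr !fischerZr mulN1r -fischer_cyclic.
have -> : f * Q = \sum_(mu <- msupp f) f@_mu *: ('X_[mu] * Q).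
  by rewrite {1}(mpolyE f) mulr_suml; apply: eq_bigr => mu _; rewrite scalerAl.
apply/eqP; rewrite subr_eq0 fischer_sumr fischer_suml; apply/eqP.
by apply: eq_bigr => mu _; rewrite fischerZl fischerZr fischerXm.
Qed.

Definition b_poly : {poly C} :=
  \prod_(d < n.+1) \prod_(c < d) ('X + 1 + (c%:R / d%:R)%:P).

Definition b_lead : C := \prod_(d < n.+1) \prod_(c < d) d%:R.

Lemma b_lead_neq0 : b_lead != 0.
Proof.
apply/prodf_neq0 => d _; apply/prodf_neq0 => c _.
by apply: natr_gt0_neq0 => //; case: d c => -[|d] ? [].
Qed.

Lemma b_poly_nat m : (b_nat n m)%:R = b_lead * b_poly.[m%:R].
Proof.
rewrite /b_nat natr_prod horner_prod /b_lead -big_split;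
  apply: eq_bigr => d _ /=.
rewrite natr_prod horner_prod -big_split; apply: eq_bigr => c _ /=.
have d0 : (d : nat)%:R != 0 :> C.
  by apply: natr_gt0_neq0 => //; case: d c => -[|d] ? [].
by rewrite !hornerE natrD natrM -natr1; field.
Qed.

Lemma b_poly_monic : b_poly \is monic.
Proof.
apply: monic_prod => d _; apply: monic_prod => c _.
by rewrite -addrA -polyC1 -polyCD monicXaddC.
Qed.

Lemma specializes_weyl D : specializes f (weyl_act f D (fs_of f))
  (fun m => \sum_(mu <- msupp D) sp m D@_mu * (f ^+ m.+1)^`M[mu]).
Proof.
apply: specializes_sum => [|mu]; first exact: cyclic_det_neq0.
apply: specializesM; apply: specializes_derivm; first exact: cyclic_det_neq0.
apply: specializes_poly => m; first by rewrite mspecialize_lift exprS.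
Qed.

Lemma specializes_scalar b : specializes f (fs_scalar N b)
  (fun m => (b.[m%:R])%:MP * f ^+ m).
Proof. by apply: specializes_poly => m; rewrite mspecializeC. Qed.

Lemma b_equation_cyclic : b_equation f b_poly.
Proof.
pose cf mu : PS := ((b_lead^-1 * f@_mu)%:P)%:MP.
pose D : weyl_s C N := \sum_(mu <- msupp f) cf mu *: 'X_[mu].
exists D.
have DE r g : weyl_act f (\sum_(mu <- r) cf mu *: 'X_[mu]) g =
    \sum_(mu <- r) (cf mu)%:F * fs_derivm f mu g.
  elim: r => [|mu r IH]; first by rewrite !big_nil /weyl_act msupp0 big_nil.
  by rewrite !big_cons weyl_actD weyl_act_mono IH.
have S : specializes f (weyl_act f D (fs_of f))
    (fun m => \sum_(mu <- msupp f) sp m (cf mu) * (f ^+ m.+1)^`M[mu]).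
  rewrite DE; apply: specializes_sum => [|mu]; first exact: cyclic_det_neq0.
  apply: specializesM; apply: specializes_derivm; first exact: cyclic_det_neq0.
  apply: specializes_poly => m; first by rewrite mspecialize_lift exprS.
apply: (specializes_eq _ _ _ C0 cyclic_det_neq0 _ _ _ _ 0 S (specializes_scalar
  _)).
move=> m _.
transitivity (b_lead^-1 *: \sum_(mu <- msupp f) f@_mu *: (f ^+ m.+1)^`M[mu]).
  rewrite scaler_sumr; apply: eq_bigr => mu _.
  by rewrite mspecializeC hornerC mul_mpolyC scalerA.
by rewrite cyclic_capelli scalerA b_poly_nat mulKf ?b_lead_neq0 // mul_mpolyC.
Qed.

(** The factor [P] makes this class stable under derivations: by the Leibniz rule
    [P h'] is [(P h)' - P' h], and the derivation of [P h] is moved to [Q f^m] as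
    a multiplication, so that no derivative of [f^m] appears. *)
Definition norm_divides (h : nat -> {mpoly C[N]}) := forall P Q : {mpoly C[N]},
  exists q : {poly C}, forall m,
    fischer (Q * f ^+ m) (P * h m) = (norm_nat n m.+1)%:R * q.[m%:R].

Lemma eq_norm_divides h1 h2 : h1 =1 h2 -> norm_divides h1 -> norm_divides h2.
Proof.
by move=> E T P Q; have [q Eq] := T P Q; exists q => m; rewrite -E.
Qed.

Lemma norm_divides_power : norm_divides (fun m => f ^+ m.+1).
Proof.
move=> P Q; have [] := pairing_quotient_poly n (msize P) C C0 P Q (leqnSn _).
by move=> q _ E; exists q.
Qed.

Lemma norm_dividesD h1 h2 : norm_divides h1 -> norm_divides h2 -> norm_divides
  (fun m => h1 m + h2 m).
Proof.
move=> T1 T2 P Q; have [q1 E1] := T1 P Q; have [q2 E2] := T2 P Q.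
by exists (q1 + q2) => m; rewrite mulrDr fischerDr E1 E2 hornerD mulrDr.
Qed.

Lemma norm_divides_sum (I : Type) (r : seq I) (h : I -> nat -> {mpoly C[N]}) :
  (forall i, norm_divides (h i)) -> norm_divides (fun m => \sum_(i <- r) h i m).
Proof.
move=> T; elim: r => [|i r IH].
  by move=> P Q; exists 0 => m; rewrite big_nil mulr0 fischer0r horner0 mulr0.
apply: eq_norm_divides (norm_dividesD _ _ (T i) IH) => m; by rewrite big_cons.
Qed.

Lemma norm_divides_horner (b : {poly C}) h : norm_divides h -> norm_divides
  (fun m => b.[m%:R] *: h m).
Proof.
move=> T P Q; have [q E] := T P Q; exists (b * q) => m.
by rewrite -scalerAr fischerZr E hornerM mulrCA.
Qed.

Lemma norm_dividesM R h : norm_divides h -> norm_divides (fun m => R * h m).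
Proof.
by move=> T P Q; have [q E] := T (P * R) Q; exists q => m; rewrite mulrA E.
Qed.

Lemma norm_divides_deriv i h : norm_divides h -> norm_divides (fun m => (h
  m)^`M(i)).
Proof.
move=> T P Q; have [q1 E1] := T P ('X_i * Q); have [q2 E2] := T (P^`M(i)) Q.
exists (q1 - q2) => m; rewrite hornerD hornerN mulrBr -E1 -E2.
by rewrite -mulrA fischerXl mderivM fischerDr addrAC subrr add0r.
Qed.

Lemma norm_divides_derivm mu h : norm_divides h -> norm_divides (fun m => (h
  m)^`M[mu]).
Proof.
elim/mnm_ind: mu h => [|i mu IH] h T.
  by apply: eq_norm_divides T => m; rewrite mderivm0m.
apply: eq_norm_divides (IH _ (norm_divides_deriv i _ T)) => m.
by rewrite mderivmDm mderivmU1m.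
Qed.

Lemma norm_divides_specialize (p : PS) h : norm_divides h -> norm_divides (fun
  m => sp m p * h m).
Proof.
move=> T; apply: (@eq_norm_divides (fun m => \sum_(mu <- msupp p)
  (p@_mu).[m%:R] *:
    ('X_[mu] * h m))).
  move=> m; rewrite [in RHS](mpolyE p) raddf_sum mulr_suml;
    apply: eq_bigr => mu _.
  by rewrite /= /mspecialize map_mpolyZ map_mpolyX scalerAl.
by apply: norm_divides_sum => mu; apply: norm_divides_horner;
  apply: norm_dividesM.
Qed.

(** Pairing the equation at [s = m] with [f^m] gives [b(m) <f^m, f^m>] on one side
    and a polynomial multiple of [<f^(m+1), f^(m+1)>] on the other. *)
Lemma b_equation_dvdp b : b_equation f b -> b_poly %| b.
Proof.
move=> [D E].
have := specializes_scalar b; rewrite -E => S.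
have [M HM] := specializes_inj _ _ _ cyclic_det_neq0 _ _ _ (specializes_weyl D)
  S.
have T : norm_divides (fun m => \sum_(mu <- msupp D) sp m D@_mu * (f ^+
  m.+1)^`M[mu]).
  apply: norm_divides_sum => mu; apply: norm_divides_specialize;
    apply: norm_divides_derivm.
  exact: norm_divides_power.
have [q Eq] := T 1 1.
suff -> : b = b_poly * (b_lead *: q) by apply: dvdp_mulr.
apply/eqP; rewrite -subr_eq0; apply/eqP;
  apply: (poly_eq0_large_nat _ C0 _ M) => m Mm.
have := Eq m; rewrite !mul1r (HM m Mm) mul_mpolyC fischerZr fischer_cyclic_norm.
have Nm := natr_gt0_neq0 _ _ C0 (norm_nat_gt0 n m).
rewrite {2}/norm_nat big_ord_recr /= natrM -/(norm_nat n m) b_poly_nat mulrC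
  -!mulrA.
by move=> /(mulfI Nm) E1; rewrite hornerD hornerN hornerM hornerZ E1; ring.
Qed.

Theorem is_b_function_cyclic_det : is_b_function f b_poly.
Proof.
split; [exact: b_poly_monic | exact: b_equation_cyclic |].
move=> b bm /b_equation_dvdp; apply: dvdp_leq; exact: monic_neq0.
Qed.

End BFunctionOfCyclicDeterminant.

Theorem theorem1p1 (R : realType) (n : nat) (hn : (1 <= n)%N) :
  is_b_function (cyclic_det R[i] n)
    (\prod_(d < n.+1) \prod_(c < d) ('X + 1 + (c%:R / d%:R)%:P)).
Proof.
apply: is_b_function_cyclic_det => k.
by rewrite pnatr_eq0.
Qed.
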